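(* There exist constants $c_1,c_2>0$ such that the homogenized energy density $f_{\rm hom}$ satisfies $$c_1(|\xi|-1)\le f_{\rm hom}(\xi)\le c_2|\xi|^2$$ for all $\xi\in\mathbb{M}^{n\times n}_{\rm sym}$.
   Context: $\mathbb{M}^{n\times n}_{\rm sym}$ is the space of symmetric real $n\times n$ matrices with Euclidean scalar product $(\cdot,\cdot)$ and norm $|\cdot|$; $a\odot b=\frac12(a\otimes b+b\otimes a)$. A positive definite symmetric linear operator $A:\mathbb{M}^{n\times n}_{\rm sym}\to\mathbb{M}^{n\times n}_{\rm sym}$ is fixed, and $\|\xi\|=(A\xi,\xi)^{1/2}$. $Y=(0,1)^n$; $B\subset\mathbb{R}^n$ is a closed rectifiable $(n-1)$-dimensional set which is $Y$-periodic, i.e. $B+k=B$ for all $k\in\mathbb{Z}^n$. $K_0$ is a closed cone in $\mathbb{M}^{n\times n}_{\rm sym}$ consisting of matrices of the form $a\odot b$, such that $a\odot(b+c)\in K_0$ whenever $a\odot b,a\odot c\in K_0$. For a matrix $\xi$, $u_\xi(x)=\xi x$. $BD$ is the space of $L^1$ vector fields $u$ whose symmetrized distributional gradient $\mathrm{E}u$ is a (finite) measure, with Lebesgue decomposition $\mathrm{E}u=\mathcal{E}u\,\mathcal{L}^n+\mathrm{E}^su$; $J_u$ is the jump set, $u^\pm$ the traces on its two sides, $\nu_u$ its unit normal. $SBD$ is the subset of $u\in BD$ with $\mathrm{E}^su=(u^+-u^-)\odot\nu_u\,\mathcal{H}^{n-1}$ restricted to $J_u$. For $\xi\in\mathbb{M}^{n\times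 n}_{\rm sym}$, $$f_{\rm hom}(\xi)=\inf\Big\{\frac12\int_Y\|\mathcal{E}u\|^2dx+\int_{J_u\cap[0,1)^n}|u^+-u^-|\,d\mathcal{H}^{n-1}\Big\},$$ the infimum being over all $u\in SBD_{\rm loc}(\mathbb{R}^n)$ with $J_u\subseteq B$, $(u^+-u^-)\odot\nu_u\in K_0$ $\mathcal{H}^{n-1}$-a.e., and $u-u_\xi$ $Y$-periodic (i.e. $\mathbb{Z}^n$-periodic). *)

(* Defs.v *)
From HB Require Import structures.
From mathcomp Require Import all_boot all_order all_algebra.
From mathcomp Require Import all_classical all_reals all_analysis.

Set Implicit Arguments.
Unset Strict Implicit.
Unset Printing Implicit Defensive.

Import Order.TTheory GRing.Theory Num.Theory.
Import numFieldNormedType.Exports.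

Local Open Scope classical_set_scope.
Local Open Scope ring_scope.

(* Points of R^n are column vectors ['cV[R]_n]. Matrices carry the Borel
   sigma-algebra of their topology. *)
HB.instance Definition _ (R : realType) (m n : nat) :=
  @isMeasurable.Build (sigma_display (@open 'M[R]_(m, n))) 'M[R]_(m, n)
    <<s (@open 'M[R]_(m, n)) >> (@sigma_algebra0 _ setT open)
    (@sigma_algebraC _ open) (@sigma_algebra_bigcup _ setT open).

Section Euclidean.
Variable R : realType.

Definition mdot m p (M N : 'M[R]_(m, p)) : R := \sum_i \sum_j M i j * N i j.

(* The library norm [`|M|] of a matrix is the sup norm, hence this one. *)
Definition enorm m p (M : 'M[R]_(m, p)) : R := Num.sqrt (mdot M M).

Definition sym_mx n (M : 'M[R]_n) : Prop := M^T = M.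

Definition symtensor n (a b : 'cV[R]_n) : 'M[R]_n :=
  2^-1 *: (a *m b^T + b *m a^T).

Definition eball n (x : 'cV[R]_n) (r : R) : set 'cV[R]_n :=
  [set y | enorm (y - x) < r].

End Euclidean.

Section Measures.
Variable R : realType.

(* Lebesgue measure on R^n, by iterated integration:
   L^0 is the unit mass at the only point, L^(n+1) = L^1 x L^n. *)
Fixpoint lebn (n : nat) : set 'cV[R]_n -> \bar R :=
  if n is n'.+1 then
    pushforward (lebesgue_measure \x @lebn n')%E
      (fun p : R * 'cV[R]_n' => col_mx (const_mx p.1 : 'cV[R]_1) p.2)
  else \d_(0 : 'cV[R]_0).

(* Volume of the unit ball of R^k (1 for k = 0). *)
Definition ball_volume (k : nat) : R := fine (lebn (eball (0 : 'cV[R]_k) 1)).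

Definition ediam n (A : set 'cV[R]_n) : R :=
  sup [set enorm (x - y) | x in A & y in A].

(* The empty set is singled out because [ediam set0 ^+ 0 = 1]. *)
Definition hausdorff_weight (k n : nat) (A : set 'cV[R]_n) : R :=
  if `[< A = set0 >] then 0 else ball_volume k * (ediam A / 2) ^+ k.

Definition hausdorff_pre (k n : nat) (delta : R) (A : set 'cV[R]_n) : \bar R :=
  ereal_inf [set (\sum_(i <oo) (hausdorff_weight k (F i))%:E)%E |
    F in [set F : (set 'cV[R]_n)^nat |
      A `<=` \bigcup_i F i /\
      forall i x y, F i x -> F i y -> enorm (x - y) <= delta]].

(* k-dimensional Hausdorff (outer) measure on R^n, normalized so as to agree
   with the k-dimensional area. *)
Definition hausdorff (k n : nat) (A : set 'cV[R]_n) : \bar R :=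
  ereal_sup [set hausdorff_pre k delta A | delta in [set d : R | 0 < d]].

Definition rectifiable (k n : nat) (B : set 'cV[R]_n) : Prop :=
  exists g : nat -> 'cV[R]_k -> 'cV[R]_n,
    (forall i, lipschitz (g i)) /\
    hausdorff k (B `\` \bigcup_i range (g i)) = 0%E.

(* Integral against a signed measure, through its Jordan decomposition. *)
Definition charge_integral d (T : measurableType d)
    (nu : {charge set T -> \bar R}) (D : set T) (f : T -> R) : R :=
  let: exist P exN := cid (Hahn_decomposition nu) in
  let: exist N nuPN := cid exN in
  fine (\int[jordan_pos nuPN]_(x in D) (f x)%:E) -
  fine (\int[jordan_neg nuPN]_(x in D) (f x)%:E).

End Measures.

Section BoundedDeformation.
Variables (R : realType) (n : nat).
Local Notation T := 'cV[R]_n.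
Implicit Types (Omega : set T) (u : T -> T) (e : T -> 'M[R]_n).

Definition partial (i : 'I_n) (phi : T -> R) : T -> R :=
  fun x => 'D_(delta_mx i 0) phi x.

Definition smooth (phi : T -> R) : Prop := forall s : seq 'I_n,
  let psi := foldr partial phi s in
  continuous psi /\ forall (i : 'I_n) x, derivable psi x (delta_mx i 0).

Definition test_function Omega (phi : T -> R) : Prop :=
  let supp := closure [set x | phi x != 0] in
  [/\ smooth phi, compact supp & supp `<=` Omega].

Definition L1_field Omega u : Prop :=
  forall i, (@lebn R n).-integrable Omega (fun x => (u x i 0)%:E).

(* [Eu i j] are the entries of the matrix-valued measure. *)
Definition is_symgrad Omega u
    (Eu : 'I_n -> 'I_n -> {charge set T -> \bar R}) : Prop :=
  forall phi, test_function Omega phi -> forall i j,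
    fine (\int[@lebn R n]_(x in Omega)
      (2^-1 * (u x i 0 * partial j phi x + u x j 0 * partial i phi x))%:E) =
    - charge_integral (Eu i j) Omega phi.

(* [u] belongs to BD(Omega), with symmetrized gradient [Eu]. *)
Definition BD Omega u (Eu : 'I_n -> 'I_n -> {charge set T -> \bar R}) : Prop :=
  L1_field Omega u /\ is_symgrad Omega u Eu.

(* [Eu = e L^n + Es] on [Omega], with [e] in L^1 and [Es] singular to L^n. *)
Definition lebesgue_decomposition Omega
    (Eu : 'I_n -> 'I_n -> {charge set T -> \bar R}) e
    (Es : 'I_n -> 'I_n -> {charge set T -> \bar R}) : Prop :=
  [/\ forall i j, (@lebn R n).-integrable Omega (fun x => (e x i j)%:E),
      forall i j A, measurable A -> A `<=` Omega ->
        Eu i j A = (\int[@lebn R n]_(x in A) (e x i j)%:E + Es i j A)%E &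
      exists N : set T, [/\ measurable N, lebn N = 0%E &
        forall i j A, measurable A -> A `<=` Omega ->
          Es i j A = Es i j (A `&` N)]].

(* [u] has at [x] the one-sided approximate limits [a] and [b], on the sides
   towards which [nu] and [- nu] point. *)
Definition half_ball (x nu : T) (r : R) : set T :=
  eball x r `&` [set y | 0 < mdot (y - x) nu].

Definition one_sided_limit u (x nu a : T) : Prop :=
  ((r ^- n)%:E * \int[@lebn R n]_(y in half_ball x nu r) (enorm (u y - a))%:E)%E
    @[r --> 0^'+] --> 0%E.

Definition jump_triple u (x : T) : set (T * T * T) :=
  [set t | let: (a, b, nu) := t in
    [/\ a != b, enorm nu = 1, one_sided_limit u x nu a
      & one_sided_limit u x (- nu) b]].

Definition jump_set u : set T := [set x | jump_triple u x !=set0].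

(* The triple (u^+, u^-, nu_u) is unique on [jump_set u] up to exchanging u^+
   and u^- while changing the sign of nu_u. Neither |u^+ - u^-| nor
   (u^+ - u^-) o nu_u depends on the choice made here. *)
Definition jump_data u (x : T) : T * T * T := xget (0, 0, 0) (jump_triple u x).
Definition trace_plus u (x : T) : T := (jump_data u x).1.1.
Definition trace_minus u (x : T) : T := (jump_data u x).1.2.
Definition jump_normal u (x : T) : T := (jump_data u x).2.

Definition jump u (x : T) : T := trace_plus u x - trace_minus u x.
Definition jump_strain u (x : T) : 'M[R]_n := symtensor (jump u x) (jump_normal u x).

(* [u] belongs to SBD(Omega) and [e] is the density of the absolutely
   continuous part of its symmetrized gradient (determined almost everywhere
   by [u]). *)
Definition SBD Omega u e : Prop :=
  exists Eu Es, [/\ BD Omega u Eu, lebesgue_decomposition Omega Eu e Es,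
    forall i j, (@hausdorff R n.-1 n).-integrable (Omega `&` jump_set u)
      (fun x => (jump_strain u x i j)%:E) &
    forall i j A, measurable A -> A `<=` Omega ->
      Es i j A = (\int[@hausdorff R n.-1 n]_(x in A `&` jump_set u)
        (jump_strain u x i j)%:E)%E].

Definition SBD_loc u e : Prop := forall Omega, open Omega -> bounded_set Omega ->
  SBD Omega u e.

End BoundedDeformation.

Section Homogenization.
Variables (R : realType) (n : nat).
Local Notation T := 'cV[R]_n.

(* An operator on the symmetric matrices is represented by any of its linear
   extensions to all square matrices. *)
Definition posdef_sym_operator (A : {linear 'M[R]_n -> 'M[R]_n}) : Prop :=
  [/\ forall xi, sym_mx xi -> sym_mx (A xi),
      forall xi eta, sym_mx xi -> sym_mx eta -> mdot (A xi) eta = mdot xi (A eta) &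
      forall xi, sym_mx xi -> xi != 0 -> 0 < mdot (A xi) xi].

Definition Anorm (A : {linear 'M[R]_n -> 'M[R]_n}) (xi : 'M[R]_n) : R :=
  Num.sqrt (mdot (A xi) xi).

Definition Zn_periodic_set (B : set T) : Prop :=
  forall k : 'cV[int]_n, [set x + map_mx intr k | x in B] = B.

Definition Zn_periodic_field (v : T -> T) : Prop :=
  forall k : 'cV[int]_n, {ae @lebn R n, forall x, v (x + map_mx intr k) = v x}.

Definition closed_cone (K : set 'M[R]_n) : Prop :=
  closed K /\ forall t xi, 0 <= t -> K xi -> K (t *: xi).

Definition slip_cone (K : set 'M[R]_n) : Prop :=
  [/\ closed_cone K,
      forall xi, K xi -> exists a b : T, xi = symtensor a b &
      forall a b c : T, K (symtensor a b) -> K (symtensor a c) ->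
        K (symtensor a (b + c))].

Definition unit_cell : set T := [set x | forall i, 0 < x i 0 < 1].
Definition half_open_cell : set T := [set x | forall i, 0 <= x i 0 < 1].

(* [e] stands for the density of the absolutely continuous part of Eu. *)
Definition admissible (B : set T) (K0 : set 'M[R]_n) (xi : 'M[R]_n)
    (u : T -> T) (e : T -> 'M[R]_n) : Prop :=
  [/\ SBD_loc u e, jump_set u `<=` B,
      {ae @hausdorff R n.-1 n, forall x, jump_set u x -> K0 (jump_strain u x)} &
      Zn_periodic_field (fun x => u x - xi *m x)].

Definition cell_energy (A : {linear 'M[R]_n -> 'M[R]_n})
    (u : T -> T) (e : T -> 'M[R]_n) : \bar R :=
  ((2^-1)%:E * \int[@lebn R n]_(x in unit_cell) (Anorm A (e x) ^+ 2)%:E +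
   \int[@hausdorff R n.-1 n]_(x in jump_set u `&` half_open_cell)
     (enorm (jump u x))%:E)%E.

Definition f_hom (A : {linear 'M[R]_n -> 'M[R]_n}) (B : set T)
    (K0 : set 'M[R]_n) (xi : 'M[R]_n) : \bar R :=
  ereal_inf [set t | exists u e, admissible B K0 xi u e /\ t = cell_energy A u e].

End Homogenization.

(* Main.v *)
(* For the upper bound, the linear field u_xi is admissible: it is continuous, so
   it has no jump, and its symmetrized gradient is the constant xi.

   For the lower bound, let u be admissible with symmetrized gradient Eu. Then
   Eu([0,1)^n) = xi. Indeed let phi_m be a product over the coordinates of smooth
   functions of the form s(t) - s(t-1), where s rises from 0 to 1 on [-1/m, 0]; it
   converges pointwise and boundedly to the indicator of [0,1)^n, so
   int phi_m dEu tends to Eu([0,1)^n). The partial derivative of phi_m in direction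
   j is a difference psi - psi(. - e_j), so translation invariance of Lebesgue
   measure and u(x + e_j) = u(x) + xi e_j give int u_i d_j phi_m = - xi_ij int psi,
   while integration by parts gives int psi = int phi_m. Hence |xi_ij| is at most
   int |e_ij| over the cell plus int |u^+ - u^-| over its jump set, and the first
   term is absorbed by the quadratic form, which is coercive on symmetric
   matrices. The density e is symmetric almost everywhere because Eu_ij and Eu_ji
   agree on boxes, by the same approximation of indicators.

   The Hausdorff integrals are only compared through the supremum over simple
   functions that defines them; this is monotone for an arbitrary set function
   vanishing on the empty set, so it does not matter here whether the Hausdorff
   outer measure is a measure and the jump set is measurable. *)
Require Import Defs.
From HB Require Import structures.
From mathcomp Require Import all_boot all_order all_algebra.
From mathcomp Require Import all_classical all_reals all_analysis.
From mathcomp Require Import measurable_realfun ring lra.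

Set Implicit Arguments.
Unset Strict Implicit.
Unset Printing Implicit Defensive.

Import Order.TTheory GRing.Theory Num.Theory.
Import numFieldNormedType.Exports.

Local Open Scope classical_set_scope.
Local Open Scope ring_scope.

(** * Borel measurability, continuity and compactness in matrix spaces *)

Section BorelMatrices.
Variables (R : realType) (m n : nat).
Local Notation M := 'M[R]_(m, n).

Lemma open_measurable_mx (U : set M) : open U -> measurable U.
Proof. by move=> oU; exact: sub_sigma_algebra. Qed.

Lemma closed_measurable_mx (U : set M) : closed U -> measurable U.
Proof.
move=> cU; rewrite -(setCK U); apply: measurableC.
by apply: open_measurable_mx; exact: closed_openC.
Qed.

Lemma continuous_measurable_mx (f : M -> R) : continuous f -> measurable_fun setT f.
Proof.
move=> /continuousP cf; apply: (measurability _ (RGenOpens.measurableE R)).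
move=> _ [_ [a [b ->] <-]]; rewrite setTI; apply: open_measurable_mx.
exact/cf/interval_open.
Qed.

Lemma measurable_coord_mx (D : set M) i j : measurable_fun D (fun A : M => A i j).
Proof.
apply: measurable_funTS; apply: continuous_measurable_mx.
exact: coord_continuous.
Qed.

(** A countable base made of half-open boxes, so that for column vectors its members are instances
    of [cbox], defined below. *)
Definition rat_box (p : 'M[rat]_(m, n) * rat) : set M :=
  [set A | forall i j, A i j \in `[ratr (p.1 i j) - ratr p.2,
                                   ratr (p.1 i j) + ratr p.2[].

Lemma open_rat_box (U : set M) (A : M) : open U -> U A ->
  exists p, rat_box p A /\ rat_box p `<=` U.
Proof.
move=> oU UA; have /nbhs_ballP[e /= e0 eU] : nbhs A U by exact: open_nbhs_nbhs.
have [r] : exists r : rat, ratr r \in `]0, e / 2[ by apply: rat_in_itvoo; lra.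
rewrite in_itv/= => /andP[r0 re].
(* The centres exceed the entries of [A] by less than [ratr r], so every point of the box is
   entrywise within [2 * ratr r < e] of [A]. *)
have qE i j : exists q : rat, ratr q \in `]A i j, A i j + ratr r[.
  by apply: rat_in_itvoo; lra.
exists (\matrix_(i, j) projT1 (cid (qE i j)), r); split.
  move=> i j /=; rewrite mxE; case: cid => q /=; rewrite !in_itv/= => /andP[? ?].
  by apply/andP; split; lra.
move=> C HC; apply: eU; split => // i j; move: (HC i j); rewrite /= mxE.
case: cid => q /=; rewrite !in_itv/= => /andP[? ?] /andP[? ?].
by rewrite /ball/= ltr_distlC; apply/andP; split; lra.
Qed.

(** An open set is a countable union of rational boxes, and membership in a box is a condition on
    finitely many entries. *)
Lemma measurable_fun_mx d (T : measurableType d) (D : set T) (f : T -> M) :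
  (forall i j, measurable_fun D (fun x => f x i j)) -> measurable_fun D f.
Proof.
move=> mf mD; apply: (@measurability _ _ _ _ _ _ (@open M)) => //.
move=> _ [U oU <-].
pose F p := if `[< rat_box p `<=` U >] then D `&` f @^-1` rat_box p else set0.
have -> : D `&` f @^-1` U = \bigcup_p F p.
  apply/seteqP; split => [x [Dx Ux]|x [p _]]; rewrite /F; last first.
    by case: asboolP => // pU [Dx px]; split => //; exact: pU.
  have [p [px pU]] := open_rat_box oU Ux.
  by exists p => //; rewrite /F; case: asboolP.
apply: countable_bigcupT_measurable; first exact: countableP.
move=> p; rewrite /F; case: asboolP => // _.
(* The trailing intersection with [D] matters when there are no entries: the intersection over [ij]
   is then the whole space. *)
rewrite (_ : _ `&` _ = \bigcap_(ij in [set: 'I_m * 'I_n])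
    (D `&` (fun x => f x ij.1 ij.2) @^-1`
      `[(ratr (p.1 ij.1 ij.2) - ratr p.2), (ratr (p.1 ij.1 ij.2) + ratr p.2)[%classic) `&` D);
    last first.
  apply/seteqP; split => [x [Dx fx]|x [fx Dx]]; split => //.
    by move=> [i j] _; split => //; exact: fx.
  by move=> i j; have [] := fx (i, j) I.
apply: measurableI => //; apply: fin_bigcap_measurable => // -[i j] _.
by apply: mf => //; exact: measurable_itv.
Qed.

Lemma continuous_to_mx (T : topologicalType) (f : T -> M) :
  (forall i j, continuous (fun x => f x i j)) -> continuous f.
Proof.
move=> cf x A [P fxP PA]; apply: (@filterS _ _ _ [set y | forall i j, P i j (f y i j)]).
  by move=> y Py; exact: PA.
apply: filter_forall => i; apply: filter_forall => j.
exact: cf.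
Qed.

Lemma mx_norm_entry_le (A : M) i j : `|A i j| <= `|A|.
Proof. by rewrite [leRHS]/Num.norm/= mx_normrE; apply/bigmax_geP; right; exists (i, j). Qed.

Lemma mx_norm_le (A : M) r : 0 <= r -> (forall i j, `|A i j| <= r) -> `|A| <= r.
Proof.
move=> r0 Ar; rewrite [leLHS]/Num.norm/= mx_normrE; by apply/bigmax_leP; split => // ij _; exact: Ar.
Qed.

End BorelMatrices.

Lemma continuous_vec_mx (R : realType) m n : continuous (@vec_mx R m n).
Proof.
apply: continuous_to_mx => i j.
rewrite (_ : (fun v => _) = (fun v : 'rV[R]_(m * n) => v 0 (mxvec_index i j))).
  exact: coord_continuous.
by apply/funext => v; rewrite mxE.
Qed.

(** Heine-Borel for row vectors, transported along the continuous bijection [vec_mx]. *)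
Lemma bounded_closed_compact_mx (R : realType) m n (A : set 'M[R]_(m, n)) :
  bounded_set A -> closed A -> compact A.
Proof.
move=> bA cA.
rewrite (_ : A = vec_mx @` (vec_mx @^-1` A)); last first.
  apply/seteqP; split => [M AM|_ [v Av <-]//].
  by exists (mxvec M); rewrite /= ?mxvecK.
apply: continuous_compact; first exact/continuous_subspaceT/continuous_vec_mx.
apply: bounded_closed_compact.
  have [b [br bA']] := bA; exists b; split => // y hy v Av /=.
  apply: mx_norm_le => [|i k]; first exact: le_trans (normr_ge0 _) (bA' y hy _ Av).
  case/mxvec_indexP: k => a c; rewrite !ord1.
  have -> : v 0 (mxvec_index a c) = vec_mx v a c by rewrite -[in LHS](vec_mxK v) mxvecE.
  exact: le_trans (mx_norm_entry_le _ _ _) (bA' y hy _ Av).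
by apply: closed_comp => // v _; exact: continuous_vec_mx.
Qed.

(** * Lebesgue measure on R^n: measure structure, volume of boxes, translation invariance *)

Section LebesgueVector.
Variable R : realType.

Definition vcons n (p : R * 'cV[R]_n) : 'cV[R]_n.+1 :=
  col_mx (const_mx p.1 : 'cV[R]_1) p.2.

Definition vbehead n (x : 'cV[R]_n.+1) : 'cV[R]_n := \col_i x (lift ord0 i) 0.

Lemma vcons0 n (p : R * 'cV[R]_n) j : vcons p ord0 j = p.1.
Proof.
have := col_mxEu (const_mx p.1 : 'cV[R]_1) p.2 ord0 j.
by rewrite [RHS]mxE => <-; congr (col_mx _ _ _ _); exact/val_inj.
Qed.

Lemma vconsS n (p : R * 'cV[R]_n) i j : vcons p (lift ord0 i) j = p.2 i j.
Proof.
have <- := col_mxEd (const_mx p.1 : 'cV[R]_1) p.2 i j.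
by congr (col_mx _ _ _ _); exact/val_inj.
Qed.

Lemma vbeheadK n (p : R * 'cV[R]_n) : vbehead (vcons p) = p.2.
Proof. by apply/colP => i; rewrite mxE vconsS. Qed.

Lemma measurable_vcons n : measurable_fun setT (@vcons n).
Proof.
apply: measurable_fun_mx => i j; case: (unliftP ord0 i) => [k|] ->.
  rewrite (_ : (fun p => _) = (fun v : 'cV[R]_n => v k j) \o snd); last first.
    by apply/funext => p; rewrite vconsS.
  by apply: measurableT_comp; [exact: measurable_coord_mx|exact: measurable_snd].
rewrite (_ : (fun p => _) = fst); first exact: measurable_fst.
by apply/funext => p; rewrite vcons0.
Qed.

Lemma measurable_vuncons n :
  measurable_fun setT (fun x : 'cV[R]_n.+1 => (x ord0 0, vbehead x)).
Proof.
apply: measurable_fun_pair; first exact: measurable_coord_mx.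
apply: measurable_fun_mx => i j.
rewrite (_ : (fun x => _) = (fun x : 'cV[R]_n.+1 => x (lift ord0 i) 0)).
  exact: measurable_coord_mx.
by apply/funext => x; rewrite mxE.
Qed.

Section VconsMeasure.
Variables (n : nat) (mu : {sigma_finite_measure set 'cV[R]_n -> \bar R}).

(** One step of the recursion defining [lebn], over an arbitrary sigma-finite factor, so that the
    measure structure can be built by induction on the dimension. *)
Definition vcons_measure : set 'cV[R]_n.+1 -> \bar R :=
  pushforward (lebesgue_measure \x mu)%E (@vcons n).

Let vcons_measure0 : vcons_measure set0 = 0%E.
Proof. by rewrite /vcons_measure /pushforward preimage_set0 measure0. Qed.

Let vcons_measure_ge0 A : (0 <= vcons_measure A)%E.
Proof. by rewrite /vcons_measure /pushforward; exact: measure_ge0. Qed.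

Let vcons_measure_sigma_additive : semi_sigma_additive vcons_measure.
Proof.
move=> F mF tF mUF.
have mV A : measurable A -> measurable (@vcons n @^-1` A).
  by move=> mA; rewrite -[X in measurable X]setTI; exact: measurable_vcons.
rewrite /vcons_measure /pushforward preimage_bigcup.
apply: measure_semi_sigma_additive => [k||]; first exact: mV.
  apply/trivIsetP => i j _ _ ij; rewrite -preimage_setI.
  by move/trivIsetP : tF => ->//; rewrite preimage_set0.
by rewrite -preimage_bigcup; exact: mV.
Qed.

HB.instance Definition _ := isMeasure.Build _ _ _ vcons_measure
  vcons_measure0 vcons_measure_ge0 vcons_measure_sigma_additive.

Let vcons_measure_sigma_finite : sigma_finite setT vcons_measure.
Proof.
have /sigma_finiteP[F [FT ndF Foo]] := sigma_finiteT (@lebesgue_measure R).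
have /sigma_finiteP[G [GT ndG Goo]] := sigma_finiteT mu.
(* Products of exhausting sets of the two factors. Both exhaustions increase, so the larger of two
   indices serves both coordinates. *)
exists (fun k => (fun x : 'cV[R]_n.+1 => (x ord0 0, vbehead x)) @^-1` (F k `*` G k)).
  apply/esym/seteqP; split => // x _.
  have [i _ Fi] : (\bigcup_i F i) (x ord0 0) by rewrite -FT.
  have [j _ Gj] : (\bigcup_i G i) (vbehead x) by rewrite -GT.
  exists (maxn i j) => //; split => /=.
    by move: Fi; apply/subsetPset/ndF/leq_maxl.
  by move: Gj; apply/subsetPset/ndG/leq_maxr.
move=> k; have [mF Fk] := Foo k; have [mG Gk] := Goo k; split.
  rewrite -[X in measurable X]setTI; apply: measurable_vuncons => //.
  exact: measurableX.
rewrite /vcons_measure /pushforward (_ : _ @^-1` _ = F k `*` G k); last first.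
  by apply/seteqP; split => p /=; rewrite vcons0 vbeheadK.
by rewrite product_measure1E// lte_mul_pinfty// ge0_fin_numE.
Qed.

HB.instance Definition _ := Measure_isSigmaFinite.Build _ _ _ vcons_measure
  vcons_measure_sigma_finite.

End VconsMeasure.

(** [lebn] is a bare fixpoint on set functions; identifying it with a structured measure lets the
    instances below be obtained by rewriting. *)
Lemma lebn_sigma_finite_measure n :
  exists mu : {sigma_finite_measure set 'cV[R]_n -> \bar R}, @lebn R n = mu.
Proof.
elim: n => [|n [mu lebE]]; first by exists \d_(0 : 'cV[R]_0).
by exists (vcons_measure mu); rewrite /= lebE.
Qed.

Section LebnMeasure.
Variable n : nat.
Local Notation L := (@lebn R n).

Let lebn0 : L set0 = 0%E.
Proof. by have [mu ->] := lebn_sigma_finite_measure n; exact: measure0. Qed.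

Let lebn_ge0 A : (0 <= L A)%E.
Proof. by have [mu ->] := lebn_sigma_finite_measure n; exact: measure_ge0. Qed.

Let lebn_sigma_additive : semi_sigma_additive L.
Proof.
by have [mu ->] := lebn_sigma_finite_measure n; exact: measure_semi_sigma_additive.
Qed.

HB.instance Definition _ := isMeasure.Build _ _ _ L
  lebn0 lebn_ge0 lebn_sigma_additive.

Let lebn_sigma_finite : sigma_finite setT L.
Proof. by have [mu ->] := lebn_sigma_finite_measure n; exact: sigma_finiteT. Qed.

HB.instance Definition _ := Measure_isSigmaFinite.Build _ _ _ L
  lebn_sigma_finite.

End LebnMeasure.

Lemma lebnS n (A : set 'cV[R]_n.+1) :
  lebn A = (lebesgue_measure \x @lebn R n)%E (@vcons n @^-1` A).
Proof. by []. Qed.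

Definition cbox n (a b : 'cV[R]_n) : set 'cV[R]_n :=
  [set x | forall i, a i 0 <= x i 0 < b i 0].

Definition obox n (a b : 'cV[R]_n) : set 'cV[R]_n :=
  [set x | forall i, a i 0 < x i 0 < b i 0].

Lemma measurable_forall_coord n (F : 'I_n -> set R) :
  (forall i, measurable (F i)) ->
  measurable [set x : 'cV[R]_n | forall i, F i (x i 0)].
Proof.
move=> mF.
rewrite (_ : mkset _ = \bigcap_(i in [set: 'I_n]) ((fun x : 'cV[R]_n => x i 0) @^-1` F i)).
  apply: fin_bigcap_measurable => // i _; rewrite -[X in measurable X]setTI.
  by apply: (@measurable_coord_mx R n 1 setT i 0).
by apply/seteqP; split => [x Fx i _|x Fx i]; [exact: Fx|exact: (Fx i I)].
Qed.

Lemma lebn_prod n (F : 'I_n -> set R) : (forall i, measurable (F i)) ->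
  lebn [set x : 'cV[R]_n | forall i, F i (x i 0)] =
  (\prod_i lebesgue_measure (F i))%E.
Proof.
elim: n F => [|n IH] F mF.
  rewrite big_ord0 /= diracE mem_set// => -[].
  by [].
rewrite lebnS (_ : _ @^-1` _ = F ord0 `*`
    [set x : 'cV[R]_n | forall i, F (lift ord0 i) (x i 0)]); last first.
  apply/seteqP; split => [p Fp|p [Fp1 Fp2]] /=.
    by split => [|i]; [rewrite -(vcons0 p 0)|rewrite -vconsS]; exact: Fp.
  by move=> i; case: (unliftP ord0 i) => [j|] ->;
    rewrite ?vcons0 ?vconsS; [exact: Fp2|exact: Fp1].
rewrite product_measure1E; [|exact: mF|
  exact: (measurable_forall_coord (fun i => mF (lift ord0 i)))].
rewrite big_ord_recl; congr (_ * _)%E.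
by apply: (IH (fun i => F (lift ord0 i))) => i; exact: mF.
Qed.

Lemma measurable_cbox n (a b : 'cV[R]_n) : measurable (cbox a b).
Proof.
apply: (@measurable_forall_coord n (fun i => [set t | a i 0 <= t < b i 0])) => i.
rewrite (_ : mkset _ = `[a i 0, b i 0[%classic); first exact: measurable_itv.
by apply/seteqP; split => t /=; rewrite in_itv.
Qed.

Lemma lebn_cbox n (a b : 'cV[R]_n) : (forall i, a i 0 <= b i 0) ->
  lebn (cbox a b) = (\prod_i (b i 0 - a i 0))%:E.
Proof.
move=> ab; rewrite -prodEFin.
rewrite (@lebn_prod n (fun i => [set t | a i 0 <= t < b i 0])) => [|i].
  apply: eq_bigr => i _.
  rewrite (_ : mkset _ = `[a i 0, b i 0[%classic); last first.
    by apply/seteqP; split => t /=; rewrite in_itv.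
  rewrite lebesgue_measure_itv/= lte_fin; case: ltP => // ba.
  by rewrite (@le_anti _ R (a i 0) (b i 0)) ?subrr// ab ba.
rewrite (_ : mkset _ = `[a i 0, b i 0[%classic); first exact: measurable_itv.
by apply/seteqP; split => t /=; rewrite in_itv.
Qed.

Lemma lebn_obox n (a b : 'cV[R]_n) : (forall i, a i 0 <= b i 0) ->
  lebn (obox a b) = (\prod_i (b i 0 - a i 0))%:E.
Proof.
move=> ab; rewrite -prodEFin.
rewrite (@lebn_prod n (fun i => [set t | a i 0 < t < b i 0])) => [|i].
  apply: eq_bigr => i _.
  rewrite (_ : mkset _ = `]a i 0, b i 0[%classic); last first.
    by apply/seteqP; split => t /=; rewrite in_itv.
  rewrite lebesgue_measure_itv/= lte_fin; case: ltP => // ba.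
  by rewrite (@le_anti _ R (a i 0) (b i 0)) ?subrr// ab ba.
rewrite (_ : mkset _ = `]a i 0, b i 0[%classic); first exact: measurable_itv.
by apply/seteqP; split => t /=; rewrite in_itv.
Qed.

Lemma open_obox n (a b : 'cV[R]_n) : open (obox a b).
Proof.
rewrite openE => x xab.
apply: (@filter_forall _ _ (fun i => [set y : 'cV[R]_n | a i 0 < y i 0 < b i 0])
  _ (nbhs_filter x)) => i.
have : open_nbhs (x i 0) `]a i 0, b i 0[%classic.
  by split; [exact: interval_open|rewrite /= in_itv/=; have := xab i].
move=> /open_nbhs_nbhs /(@coord_continuous R n 1 i 0 x).
by apply: (@filterS _ _ (nbhs_filter x)) => y /=; rewrite in_itv.
Qed.

(** By uniqueness: the translated measure has the right value on half-open intervals. *)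
Lemma lebesgue_measure_translate (a : R) (A : set R) : measurable A ->
  lebesgue_measure ((fun x => x + a) @^-1` A) = lebesgue_measure A.
Proof.
move=> mA.
have ma : measurable_fun setT (fun x : R => x + a).
  by apply: measurable_funD => //; exact: measurable_id.
transitivity (pushforward lebesgue_measure
  ((fun x => x + a) : R -> measurableTypeR R) A) => //.
apply/esym/lebesgue_measure_unique => //= _ [[c d]] _ <-.
rewrite /pushforward (_ : _ @^-1` _ = `](c - a), (d - a)]%classic).
  by rewrite !lebesgue_measure_itv/= !lte_fin ltrD2r -!EFinB; congr (if _ then EFin _ else _); ring.
by apply/seteqP; split => x /=; rewrite !in_itv/= lerBrDr ltrBlDr.
Qed.

(** Induction on the dimension by slicing: the induction hypothesis removes the shift inside each
    slice, and one-dimensional invariance removes the shift of the slicing variable. *)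
Lemma lebn_translate n (v : 'cV[R]_n) (A : set 'cV[R]_n) : measurable A ->
  lebn ((fun x => x + v) @^-1` A) = lebn A.
Proof.
elim: n v A => [|n IH] v A mA.
  by congr lebn; apply/seteqP; split => x /=; rewrite [_ + _]flatmx0 [x]flatmx0.
have mVA : measurable (@vcons n @^-1` A : set (measurableTypeR R * 'cV[R]_n)%type).
  by rewrite -[X in measurable X]setTI; exact: measurable_vcons.
rewrite !lebnS /product_measure1.
pose g x := lebn (xsection (@vcons n @^-1` A) x).
have vconsD x y : vcons (x, y) + v = vcons (x + v ord0 0, y + vbehead v).
  apply/colP => i; rewrite mxE; case: (unliftP ord0 i) => [j|] ->.
    by rewrite !vconsS !mxE.
  by rewrite !vcons0.
transitivity (\int[lebesgue_measure]_x (g \o (fun x => (x + v ord0 0)%R)) x)%E.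
  apply: eq_integral => x _.
  rewrite /g/= -[RHS](IH (vbehead v)); last exact: measurable_xsection.
  by congr lebn; apply/seteqP; split => y; rewrite /xsection/= !inE/= vconsD.
have mg : measurable_fun setT (g : measurableTypeR R -> \bar R) by
  exact: (@measurable_fun_xsection _ _ _ _ _ (@lebn R n) _ mVA).
have ma : measurable_fun setT
    ((fun x => x + v ord0 0) : measurableTypeR R -> measurableTypeR R) by apply: measurable_funD.
rewrite -[LHS](@ge0_integral_pushforward _ _ _ _ _ _ ma lebesgue_measure setT)//.
apply: eq_measure_integral => B mB _.
exact: lebesgue_measure_translate.
Qed.

End LebesgueVector.

(** * The flat exponential and its derivatives *)

Section FlatExp.
Variable R : realType.

(** The powers of [t^-1] make the linear span of the family closed under differentiation. *)
Definition flat_exp (k : nat) (t : R) : R :=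
  if 0 < t then t^-1 ^+ k * expR (- t^-1) else 0.

Lemma flat_exp_le0 k t : t <= 0 -> flat_exp k t = 0.
Proof. by rewrite /flat_exp; case: ltP. Qed.

Lemma flat_exp_gt0 k t : 0 < t -> 0 < flat_exp k t.
Proof. by move=> t0; rewrite /flat_exp t0 mulr_gt0 ?exprn_gt0 ?invr_gt0 ?expR_gt0. Qed.

Lemma flat_exp_ge0 k t : 0 <= flat_exp k t.
Proof. by have [/flat_exp_le0->//|/flat_exp_gt0/ltW] := leP t 0. Qed.

(** The exponential dominates each term of its series: [exp s >= s^(k+1) / (k+1)!] at [s = t^-1]. *)
Lemma flat_exp_le_linear k t : flat_exp k t <= (k.+1)`!%:R * `|t|.
Proof.
have [/flat_exp_le0->|t0] := leP t 0; first by rewrite mulr_ge0.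
rewrite /flat_exp t0 gtr0_norm// expRN ler_pdivrMr ?expR_gt0//.
have := expR_ge1Dxn k (ltW (_ : 0 < t^-1)); rewrite invr_gt0 => /(_ t0) h.
rewrite -mulrA -ler_pdivrMl ?ltr0n ?fact_gt0// -ler_pdivrMl//.
apply: le_trans h; rewrite mulrCA -exprS.
by rewrite [leLHS]mulrC lerDr.
Qed.

Lemma is_derive_flat_exp k (t : R) :
  is_derive t 1 (flat_exp k) (flat_exp k.+2 t - k%:R * flat_exp k.+1 t).
Proof.
have [t0|t0|->] := ltgtP t 0.
- rewrite !flat_exp_le0 ?(ltW t0)// mulr0 subr0.
  have d0 : is_derive t (1 : R) (cst (0 : R)) (0 : R) by exact: is_derive_cst.
  apply: near_eq_is_derive d0; near=> s; rewrite /= flat_exp_le0//; apply/ltW; near: s.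
  exact: lt_nbhsl.
- have tn0 : id t != 0 by rewrite gt_eqF.
  have dV : is_derive t (1 : R) (fun s : R => s^-1) (- t ^- 2 *: 1).
    exact: (is_deriveV tn0 (is_derive_id _ _)).
  have dE : is_derive t (1 : R) (fun s : R => expR (- s^-1))
      (expR (- t^-1) * - (- t ^- 2 *: 1)).
    exact: (is_derive1_comp (is_derive_expR _) (is_deriveN dV)).
  apply: near_eq_is_derive (is_derive_eq (is_deriveM (is_deriveX k dV) dE) _).
    near=> s; rewrite /flat_exp ifT ?exprfctE//; near: s.
    exact: lt_nbhsr.
  rewrite /flat_exp t0 /GRing.scale/= exprfctE -exprVn !mulr1.
  case: k {dE} => [|k]; first by rewrite !expr0 !mul0r; ring.
  by rewrite /= !exprS; ring.
- rewrite !flat_exp_le0// mulr0 subr0.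
  (* At 0 the difference quotient of [flat_exp k] is [flat_exp k.+1], which the linear bound sends
     to 0. *)
  have lim0 : (fun h : R => h^-1 *: ((flat_exp k \o shift 0) (h *: 1) -
      flat_exp k 0)) @ 0^' --> (0 : R).
    apply: (@cvg_to_0_linear _ _ (k.+2)`!%:R 1) => // h /andP[h0 _].
    rewrite /= [_%:A]mulr1 addr0 (flat_exp_le0 k (lexx 0)) subr0.
    apply: le_trans (flat_exp_le_linear k.+1 h); rewrite /GRing.scale/=.
    have [hle|hgt] := leP h 0; first by rewrite !flat_exp_le0// mulr0 normr0.
    rewrite /flat_exp hgt ger0_norm ?exprS ?mulrA//.
    by rewrite -mulrA mulr_ge0 ?invr_ge0 ?(ltW hgt)// mulr_ge0 ?expR_ge0 ?exprn_ge0 ?invr_ge0 ?(ltW hgt).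
  by apply: DeriveDef; [exact: cvgP lim0|exact: cvg_lim lim0].
Unshelve. all: by end_near. Qed.

Lemma is_derive_flat_exp_affine k (a b t : R) :
  is_derive t 1 (fun s => flat_exp k (a * s + b))
    ((flat_exp k.+2 (a * t + b) - k%:R * flat_exp k.+1 (a * t + b)) * a).
Proof.
have da : is_derive t (1 : R) (fun s => a * s + b) a.
  have := is_deriveD (is_deriveZ a (is_derive_id t (1 : R))) (is_derive_cst b t (1 : R)).
  by rewrite addr0 [_%:A]mulr1.
exact: (is_derive1_comp (is_derive_flat_exp k _) da).
Qed.

End FlatExp.

(** * Smooth functions generated by flat exponentials of the coordinates *)

Section SmoothFun.
Variables (R : realType) (n : nat).
Local Notation T := 'cV[R]_n.
Local Notation unitv j := (delta_mx j 0 : T).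

(* A class of functions closed under partial derivatives, rich enough to
   contain cutoffs of boxes. *)
Inductive smooth_expr : (T -> R) -> Prop :=
| SmoothCst c : smooth_expr (fun _ => c)
| SmoothFlat k a b i : smooth_expr (fun x => flat_exp k (a * x i 0 + b))
| SmoothAdd f g : smooth_expr f -> smooth_expr g -> smooth_expr (fun x => f x + g x)
| SmoothMul f g : smooth_expr f -> smooth_expr g -> smooth_expr (fun x => f x * g x)
| SmoothInv f : smooth_expr f -> (forall x, f x != 0) -> smooth_expr (fun x => (f x)^-1).

(** Both sides have the same difference quotient; this transfers one-variable derivatives to
    directional ones. *)
Lemma is_derive_lineP (f : T -> R) (x v : T) (t l : R) :
  is_derive t (1 : R) (fun s : R => f (s *: v + x)) l <->
  is_derive (t *: v + x) v f l.
Proof.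
have E : (fun h : R => h^-1 *: ((f \o shift (t *: v + x)) (h *: v) - f (t *: v + x))) =
  (fun h : R => h^-1 *: (((fun s : R => f (s *: v + x)) \o shift t) (h *: 1) -
    f (t *: v + x))).
  by apply/funext => h; rewrite /= [_%:A]mulr1 scalerDl addrA.
by split => -[dv dl]; apply: DeriveDef; move: dv dl; rewrite /derivable /derive E.
Qed.

Lemma smooth_expr_continuous f : smooth_expr f -> continuous f.
Proof.
elim=> {f} [c|k a b i|f g _ cf _ cg|f g _ cf _ cg|f _ cf f0] x.
- exact: cst_continuous.
- apply: (@continuous_comp _ _ _ (fun x : T => x i 0)
      (fun t => flat_exp k (a * t + b))); first exact: coord_continuous.
  apply/differentiable_continuous/derivable1_diffP.
  by have [] := is_derive_flat_exp_affine k a b (x i 0).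
- exact: cvgD (cf x) (cg x).
- exact: cvgM (cf x) (cg x).
- exact: cvgV (f0 x) (cf x).
Qed.

Lemma smooth_expr_derive f j : smooth_expr f ->
  exists2 df, smooth_expr df & forall x, is_derive x (unitv j) f (df x).
Proof.
elim=> {f} [c|k a b i|f g sf [df sdf df_] sg [dg sdg dg_]|
  f g sf [df sdf df_] sg [dg sdg dg_]|f sf [df sdf df_] f0].
- by exists (fun=> 0); [exact: SmoothCst|move=> x; exact: is_derive_cst].
- exists (fun x => (flat_exp k.+2 (a * x i 0 + b) +
      - k%:R * flat_exp k.+1 (a * x i 0 + b)) * (a * (i == j)%:R)).
    by do 2?[constructor => //]; constructor; constructor.
  move=> x; have := @is_derive_lineP (fun x => flat_exp k (a * x i 0 + b)) x (unitv j) 0.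
  rewrite scale0r add0r => lineP; apply/lineP => {lineP}.
  have := is_derive_flat_exp_affine k (a * (i == j)%:R) (a * x i 0 + b) 0.
  rewrite mulr0 add0r mulNr; congr (is_derive _ _ _ _).
  by apply/funext => t; rewrite !mxE eqxx andbT; congr flat_exp; ring.
- exists (fun x => df x + dg x); first exact: SmoothAdd.
  by move=> x; exact: is_deriveD.
- exists (fun x => f x * dg x + g x * df x).
    by apply: SmoothAdd; apply: SmoothMul.
  by move=> x; exact: is_deriveM.
- exists (fun x => -1 * ((f x)^-1 * (f x)^-1) * df x).
    by do !apply: SmoothMul => //; [exact: SmoothCst|exact: SmoothInv|exact: SmoothInv].
  move=> x; have [dv <-] := df_ x; apply: DeriveDef; first exact: derivableV.
  by rewrite deriveV// mulN1r expr2 invfM.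
Qed.

Lemma smooth_expr_smooth f : smooth_expr f -> smooth f.
Proof.
move=> sf s; have sg : smooth_expr (foldr (@partial R n) f s).
  elim: s => //= i s /(smooth_expr_derive i)[df sdf df_].
  rewrite (_ : partial i _ = df)//; apply/funext => x.
  by rewrite /partial; have [_ ->] := df_ x.
split=> [|i x]; first exact: smooth_expr_continuous.
by have [df _ /(_ x)[]] := smooth_expr_derive i sg.
Qed.

Lemma smooth_expr_prod (I : Type) (r : seq I) (P : pred I) (F : I -> T -> R) :
  (forall i, P i -> smooth_expr (F i)) ->
  smooth_expr (fun x => \prod_(i <- r | P i) F i x).
Proof.
move=> sF; elim: r => [|i r IH].
  rewrite (_ : (fun x => _) = fun=> 1); first exact: SmoothCst.
  by apply/funext => x; rewrite big_nil.
have [Pi|nPi] := boolP (P i).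
  rewrite (_ : (fun x => _) = fun x => F i x * \prod_(j <- r | P j) F j x).
    by apply: SmoothMul => //; exact: sF.
  by apply/funext => x; rewrite big_cons Pi.
rewrite (_ : (fun x => _) = fun x => \prod_(j <- r | P j) F j x)//.
by apply/funext => x; rewrite big_cons (negbTE nPi).
Qed.

End SmoothFun.

(** * One-dimensional smooth cutoffs *)

Section Cutoff.
Variable R : realType.

Definition smooth_step (t : R) : R :=
  flat_exp 0 t / (flat_exp 0 t + flat_exp 0 (1 - t)).

(** At least one of [t] and [1 - t] is positive. *)
Lemma smooth_step_den_gt0 (t : R) : 0 < flat_exp 0 t + flat_exp 0 (1 - t).
Proof.
have [t0|t0] := leP t 0; last by rewrite ltr_pwDl ?flat_exp_gt0 ?flat_exp_ge0.
by rewrite ltr_wpDl ?flat_exp_ge0// flat_exp_gt0//; lra.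
Qed.

Lemma smooth_step_ge0 t : 0 <= smooth_step t.
Proof. by rewrite divr_ge0 ?flat_exp_ge0// ltW ?smooth_step_den_gt0. Qed.

Lemma smooth_step_le1 t : smooth_step t <= 1.
Proof. by rewrite ler_pdivrMr ?smooth_step_den_gt0// mul1r lerDl flat_exp_ge0. Qed.

Lemma smooth_step0 t : t <= 0 -> smooth_step t = 0.
Proof. by move=> t0; rewrite /smooth_step flat_exp_le0// mul0r. Qed.

Lemma smooth_step1 t : 1 <= t -> smooth_step t = 1.
Proof.
move=> t1; rewrite /smooth_step [flat_exp 0 (1 - t)]flat_exp_le0; last by lra.
by rewrite addr0 divff// gt_eqF// flat_exp_gt0//; lra.
Qed.

(* Equals 0 before [a - e] and 1 from [a] on, so that differences of ramps tend
   to indicators of half-open intervals. *)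
Definition ramp (e a t : R) : R := smooth_step ((t - a) / e + 1).

Lemma ramp_ge0 e a t : 0 <= ramp e a t. Proof. exact: smooth_step_ge0. Qed.

Lemma ramp_le1 e a t : ramp e a t <= 1. Proof. exact: smooth_step_le1. Qed.

Lemma ramp0 e a t : 0 < e -> t <= a - e -> ramp e a t = 0.
Proof.
move=> e0 ta; apply: smooth_step0.
have : (t - a) / e <= -1 by rewrite ler_pdivrMr//; lra.
lra.
Qed.

Lemma ramp1 e a t : 0 < e -> a <= t -> ramp e a t = 1.
Proof.
by move=> e0 ta; apply: smooth_step1; rewrite lerDr divr_ge0 ?(ltW e0)// subr_ge0.
Qed.

Definition bump (e a b t : R) : R := ramp e a t - ramp e b t.

Lemma bump_norm_le1 e a b t : `|bump e a b t| <= 1.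
Proof.
rewrite ler_norml /bump.
have := ramp_ge0 e a t; have := ramp_le1 e a t.
have := ramp_ge0 e b t; have := ramp_le1 e b t; lra.
Qed.

Lemma bump0 e a b t : 0 < e -> a <= b -> ~~ (a - e < t < b) -> bump e a b t = 0.
Proof.
move=> e0 ab; rewrite negb_and -!leNgt /bump => /orP[ta|bt].
  by rewrite !ramp0// ?subrr//; lra.
by rewrite !ramp1// ?subrr//; lra.
Qed.

(** Each ramp rises to the left of its threshold, so the limit keeps [a] and omits [b]. At a fixed
    [t] the value is reached exactly once [e] is small. *)
Lemma bump_indic a b t : a <= b ->
  \forall e \near 0^'+, bump e a b t = (a <= t < b)%R%:R.
Proof.
move=> ab; have [ta|ta] := ltP t a; last have [tb|tb] := ltP t b.
- near=> e; rewrite bump0//= negb_and -leNgt; apply/orP; left.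
  by rewrite lerBrDr -lerBrDl; near: e; apply: nbhs_right_le; rewrite subr_gt0.
- near=> e; rewrite /bump ramp1// ramp0// ?subr0//.
  by rewrite lerBrDr -lerBrDl; near: e; apply: nbhs_right_le; rewrite subr_gt0.
- by near=> e; rewrite bump0//= negb_and -!leNgt tb orbT.
Unshelve. all: by end_near. Qed.

(** The reason why the cutoff of the unit cell telescopes under the shift by a basis vector. *)
Lemma rampB1 e a t : ramp e (a + 1) t = ramp e a (t - 1).
Proof. by rewrite /ramp opprD addrA addrAC. Qed.

End Cutoff.

(** * Cutoffs of boxes as test functions *)

Section BoxCutoff.
Variables (R : realType) (n : nat).
Local Notation T := 'cV[R]_n.
Implicit Types (a b : T) (e : R).

Definition box_cutoff e a b (x : T) : R := \prod_i bump e (a i 0) (b i 0) (x i 0).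

Lemma smooth_expr_sub (f g : T -> R) :
  smooth_expr f -> smooth_expr g -> smooth_expr (fun x => f x - g x).
Proof.
move=> sf sg; under eq_fun do rewrite -mulN1r.
by apply: SmoothAdd => //; apply: SmoothMul => //; exact: SmoothCst.
Qed.

Lemma smooth_expr_ramp e c i : smooth_expr (fun x : T => ramp e c (x i 0)).
Proof.
rewrite (_ : (fun x => _) = fun x : T =>
    flat_exp 0 (e^-1 * x i 0 + (1 - c / e)) *
    (flat_exp 0 (e^-1 * x i 0 + (1 - c / e)) +
     flat_exp 0 (- e^-1 * x i 0 + c / e))^-1).
  apply: SmoothMul; first exact: SmoothFlat.
  apply: SmoothInv; first by apply: SmoothAdd; exact: SmoothFlat.
  move=> x; rewrite gt_eqF//.
  rewrite (_ : - e^-1 * x i 0 + c / e = 1 - (e^-1 * x i 0 + (1 - c / e))).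
    exact: smooth_step_den_gt0.
  by ring.
apply/funext => x; rewrite /ramp /smooth_step.
by congr (flat_exp 0 _ / (flat_exp 0 _ + flat_exp 0 _)); ring.
Qed.

Lemma smooth_expr_box_cutoff e a b : smooth_expr (box_cutoff e a b).
Proof.
by apply: smooth_expr_prod => i _; apply: smooth_expr_sub; exact: smooth_expr_ramp.
Qed.

Lemma box_cutoff_norm_le1 e a b x : `|box_cutoff e a b x| <= 1.
Proof.
rewrite normr_prod; apply: prodr_ile1 => i.
by rewrite normr_ge0 bump_norm_le1.
Qed.

Lemma box_cutoff_supp e a b x : 0 < e -> (forall i, a i 0 <= b i 0) ->
  box_cutoff e a b x != 0 -> forall i, a i 0 - e < x i 0 < b i 0.
Proof.
move=> e0 ab; apply: contra_neqP => /existsNP[i /negP abx].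
by rewrite /box_cutoff (bigD1 i)//= bump0// mul0r.
Qed.

Lemma box_cutoff_indic a b x : (forall i, a i 0 <= b i 0) ->
  \forall e \near 0^'+, box_cutoff e a b x = \1_(cbox a b) x.
Proof.
move=> ab; have h : \forall e \near 0^'+, forall i,
    bump e (a i 0) (b i 0) (x i 0) = (a i 0 <= x i 0 < b i 0)%R%:R.
  by apply: filter_forall => i; exact: bump_indic.
apply: filterS h => e he; rewrite /box_cutoff (eq_bigr _ (fun i _ => he i)) indicE.
case: (pselect (cbox a b x)) => [xab|xab].
  by rewrite mem_set// big1// => i _; rewrite xab.
rewrite memNset//; move/existsNP : xab => [i /negP/negbTE h].
by rewrite (bigD1 i)//= h mul0r.
Qed.

Definition kbox a b : set T := [set x | forall i, a i 0 <= x i 0 <= b i 0].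

Lemma closed_kbox a b : closed (kbox a b).
Proof.
rewrite (_ : kbox a b = \bigcap_(i in [set: 'I_n])
    (fun x : T => x i 0) @^-1` `[a i 0, b i 0]%classic).
  apply: closed_bigI => i _.
  by apply: closed_comp; [move=> x _; exact: coord_continuous|exact: interval_closed].
by apply/seteqP; split => [x h i _|x h i]; [|have := h i I]; rewrite /= in_itv//=.
Qed.

Lemma bounded_kbox a b : bounded_set (kbox a b).
Proof.
exists (`|a| + `|b|); split; first by rewrite num_real.
move=> M hM x abx; apply: mx_norm_le => [|i j].
  by apply: le_trans (ltW hM); rewrite addr_ge0.
rewrite ord1; apply: le_trans (ltW hM).
have := mx_norm_entry_le a i 0; have := mx_norm_entry_le b i 0.
move: (abx i) => /andP[] h1 h2.
have := ler_norm (b i 0); have := ler_norm (- a i 0); rewrite normrN => *.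
rewrite ler_norml; apply/andP; split; last by have := normr_ge0 a; lra.
by have := normr_ge0 b; lra.
Qed.

Lemma compact_kbox a b : compact (kbox a b).
Proof. by apply: bounded_closed_compact_mx; [exact: bounded_kbox|exact: closed_kbox]. Qed.

Lemma test_function_box_cutoff e a b (Omega : set T) : 0 < e ->
  (forall i, a i 0 <= b i 0) -> kbox (a - const_mx e) b `<=` Omega ->
  test_function Omega (box_cutoff e a b).
Proof.
move=> e0 ab abO.
have sub : closure [set x | box_cutoff e a b x != 0] `<=` kbox (a - const_mx e) b.
  rewrite [X in _ `<=` X](closure_id _).1; last exact: closed_kbox.
  apply: closure_subset => x /= /(box_cutoff_supp e0 ab) xab i.
  by rewrite !mxE; have /andP[/ltW-> /ltW->] := xab i.
split; first exact/smooth_expr_smooth/smooth_expr_box_cutoff.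
- by apply: (subclosed_compact _ (@compact_kbox _ _) sub); exact: closed_closure.
- exact: subset_trans abO.
Qed.

End BoxCutoff.

(** * Integrals of compactly supported functions *)

Section CompactlySupported.
Variables (R : realType) (n : nat).
Local Notation T := 'cV[R]_n.
Local Notation L := (@lebn R n).
Local Notation unitv j := (delta_mx j 0 : T).

(** A ball of the sup norm, hence a closed cube. *)
Definition nball (r : R) : set T := [set x | `|x| <= r].

Lemma closed_nball r : closed (nball r).
Proof.
rewrite (_ : nball r = (fun x : T => `|x|) @^-1` [set t | t <= r])//.
by apply: closed_comp; [move=> x _; exact: norm_continuous|exact: closed_le].
Qed.

Lemma compact_nball r : compact (nball r).
Proof.
apply: bounded_closed_compact_mx; last exact: closed_nball.
by exists r; split; rewrite ?num_real// => s rs x /= xr; apply: le_trans (ltW rs).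
Qed.

Lemma measurable_nball r : measurable (nball r).
Proof. by apply: closed_measurable_mx; exact: closed_nball. Qed.

Lemma lebn_nball_lty r : (L (nball r) < +oo)%E.
Proof.
have h i : (const_mx (- (`|r| + 1)) : T) i 0 <= (const_mx (`|r| + 1) : T) i 0.
  by rewrite !mxE; have := normr_ge0 r; lra.
apply: (@le_lt_trans _ _ (L (cbox (const_mx (- (`|r| + 1))) (const_mx (`|r| + 1))))).
  apply: le_measure; rewrite ?inE; [exact: measurable_nball|exact: measurable_cbox|].
  move=> x /= xr i; rewrite !mxE.
  have := le_trans (mx_norm_entry_le x i 0) xr; rewrite ler_norml => /andP[? ?].
  by have := ler_norm r; apply: contraTT; lra.
by rewrite lebn_cbox// ltry.
Qed.

(** Compact support with an explicit radius, which is easy to follow under translation. *)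
Definition vanish_off (r : R) (g : T -> R) := forall x, r < `|x| -> g x = 0.

Lemma vanish_off_bounded r g : continuous g -> vanish_off r g ->
  exists2 C, 0 <= C & forall x, `|g x| <= C.
Proof.
move=> cg vg.
have /ex_strict_bound_gt0[C C0 gC] : bounded_set (g @` nball r).
  apply: compact_bounded; apply: continuous_compact; last exact: compact_nball.
  exact: continuous_subspaceT.
exists C => [|x]; first exact: ltW.
have [xr|rx] := leP `|x| r; first by apply/ltW/gC; exists x.
by rewrite vg// normr0 ltW.
Qed.

Lemma integrable_vanish_off r (g : T -> R) (C : R) : measurable_fun setT g ->
  vanish_off r g -> (forall x, `|g x| <= C) -> L.-integrable setT (EFin \o g).
Proof.
move=> mg vg gC.
have -> : EFin \o g = (EFin \o g) \_ (nball r).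
  apply/funext => x; rewrite patchE; case: ifPn => //.
  by rewrite notin_setE /= => /negP; rewrite -ltNge => rx; rewrite vg.
apply/(integrable_mkcond _ (measurable_nball r)).
apply: measurable_bounded_integrable; [exact: measurable_nball|exact: lebn_nball_lty|
  exact: measurable_funTS|].
exists C; split; first by rewrite num_real.
by move=> D CD x _ /=; apply: le_trans (gC x) (ltW CD).
Qed.

Lemma integrable_continuous_vanish_off r (g : T -> R) : continuous g ->
  vanish_off r g -> L.-integrable setT (EFin \o g).
Proof.
move=> cg vg; have [C _ gC] := vanish_off_bounded cg vg.
exact: (integrable_vanish_off (continuous_measurable_mx cg) vg gC).
Qed.

Lemma measurable_translate (v : T) : measurable_fun setT (fun x : T => x + v).
Proof.
apply: measurable_fun_mx => i j.
rewrite (_ : (fun x => _) = fun x : T => x i j + v i j); last first.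
  by apply/funext => x; rewrite mxE.
by apply: measurable_funD => //; exact: measurable_coord_mx.
Qed.

Lemma ge0_integral_translate (v : T) (f : T -> \bar R) :
  measurable_fun setT f -> (forall x, 0 <= f x)%E ->
  (\int[L]_x f (x + v)%R = \int[L]_x f x)%E.
Proof.
move=> mf f0.
rewrite -[LHS](@ge0_integral_pushforward _ _ _ _ _ _ (measurable_translate v) L setT f)//.
apply: eq_measure_integral => [|mv A mA _].
  exact: measurable_translate.
exact: lebn_translate.
Qed.

Lemma integral_translate (v : T) (f : T -> \bar R) : measurable_fun setT f ->
  (\int[L]_x f (x + v)%R = \int[L]_x f x)%E.
Proof.
move=> mf; rewrite integralE [RHS]integralE; congr (_ - _)%E.
  rewrite -[RHS](ge0_integral_translate v (measurable_funepos mf) (funepos_ge0 f)).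
  by apply: eq_integral => x _; rewrite !funeposE.
rewrite -[RHS](ge0_integral_translate v (measurable_funeneg mf) (funeneg_ge0 f)).
by apply: eq_integral => x _; rewrite !funenegE.
Qed.

(** By translation invariance the integral of [g (t *: unitv j + y)] in [y] does not depend on [t];
    differentiate it at [t = 0] under the integral sign. *)
Lemma integral_partial_eq0 r (g : T -> R) j : continuous g ->
  (forall x, derivable g x (unitv j)) -> continuous (partial j g) ->
  vanish_off r g -> vanish_off r (partial j g) ->
  \int[L]_x partial j g x = 0.
Proof.
move=> cg dg cdg vg vdg.
have [C C0 dgC] := vanish_off_bounded cdg vdg.
pose f (t : R) (y : T) := g (t *: unitv j + y).
have df t y : is_derive t (1 : R) (f ^~ y) (partial j g (t *: unitv j + y)).
  by apply/is_derive_lineP; exact/derivableP.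
have cf t : continuous (f t).
  move=> y; apply: continuous_comp; last exact: cg.
  by apply: (@continuousD _ _ _ (cst (t *: unitv j)) id); [exact: cst_continuous|].
have If t : \int[L]_y f t y = \int[L]_y g y.
  have mg : measurable_fun setT (EFin \o g).
    by apply/measurable_EFinP; exact: (continuous_measurable_mx cg).
  congr fine; rewrite -[RHS](integral_translate (t *: unitv j) mg).
  by apply: eq_integral => y _; rewrite /f/= addrC.
(* The dominating function for [-1 < t < 1]: such a shift moves points by at most 1, so the
   derivative vanishes outside radius [r + 1]. *)
pose G := fun y : T => C * \1_(nball (r + 1)) y.
have G0 y : 0 <= G y by rewrite mulr_ge0.
have e1 : `|unitv j| <= 1.
  by apply: mx_norm_le => // k l; rewrite mxE; case: (_ && _); rewrite ?normr1 ?normr0.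
have small t y : -1 < t < 1 -> r + 1 < `|y| -> r < `|t *: unitv j + y|.
  move=> /andP[t1 t2] ry.
  have := ler_normB (t *: unitv j + y) (t *: unitv j).
  rewrite addrC addKr normrZ => h.
  have : `|t| * `|unitv j| <= 1 by rewrite mulr_ile1// ler_norml; lra.
  lra.
have intf t : -1 < t < 1 -> L.-integrable setT (EFin \o f t).
  move=> t1; apply: (@integrable_continuous_vanish_off (r + 1)) => // y ry.
  by apply: vg; exact: small.
have p1E t y : partial1of2 f t y = partial j g (t *: unitv j + y).
  by rewrite /partial1of2 derive1E; have [_ ->] := df t y.
have bdd t y : -1 < t < 1 -> `|partial1of2 f t y| <= G y.
  move=> t1; rewrite p1E /G indicE; case: (leP `|y| (r + 1)) => [yr|ry].
    by rewrite mem_set// mulr1.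
  rewrite vdg ?normr0 ?mulr_ge0//; exact: small.
have intG : L.-integrable setT (EFin \o G).
  apply: (@integrable_vanish_off (r + 1) _ C).
  - apply: measurable_funM => //.
    by apply: measurable_indic; exact: measurable_nball.
  - move=> x rx; rewrite /G indicE memNset ?mulr0//.
    by rewrite /nball/=; apply/negP; rewrite -ltNge.
  - by move=> x; rewrite ger0_norm// /G indicE; case: (_ \in _); rewrite ?mulr1 ?mulr0.
have := @cvg_differentiation_under_integral R _ T L f setT measurableT 0 (-1) 1.
move=> /(_ _ _ _ G G0 intG) h.
have /cvg_lim <-// : (fun t : R => t^-1 *: (\int[L]_y f (t + 0) y - \int[L]_y f 0 y)) @ 0^' -->
    \int[L]_y partial j g y.
  rewrite (_ : Rintegral L setT (partial j g) = \int[L]_y partial1of2 f 0 y).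
    apply: h => [|t|t y|t y] /=; rewrite ?in_itv/=; [lra|exact: intf|move=> _ _|by move=> + _; exact: bdd].
    by have [] := df t y.
  by apply: eq_Rintegral => y _; rewrite p1E scale0r add0r.
under eq_fun do rewrite !If subrr scaler0.
by apply/cvg_lim => //; exact: cvg_cst.
Qed.

End CompactlySupported.

(** * Integration against signed measures *)

Section ChargeIntegral.
Context d (T : measurableType d) (R : realType).

(** Hides the chosen Hahn decomposition: from here on only a difference of two finite measures is
    handled. *)
Lemma charge_integral_jordan (nu : {charge set T -> \bar R}) :
  exists p q : {finite_measure set T -> \bar R},
    (forall A, measurable A -> nu A = (p A - q A)%E) /\
    forall D f, charge_integral nu D f =
      \int[p]_(x in D) f x - \int[q]_(x in D) f x.
Proof.
rewrite /charge_integral; case: cid => P exN; case: cid => N nuPN.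
exists (jordan_pos nuPN), (jordan_neg nuPN); split => // A mA.
by rewrite (jordan_decomp nuPN mA) /cadd/= cscaleN1.
Qed.

Lemma Rintegral_indic_cvg (p : {finite_measure set T -> \bar R}) (D A : set T)
    (f : nat -> T -> R) : measurable D -> measurable A -> A `<=` D ->
  (forall m, measurable_fun D (f m)) -> (forall m x, `|f m x| <= 1) ->
  (forall x, D x -> f ^~ x @ \oo --> (\1_A x : R)) ->
  (fun m => \int[p]_(x in D) f m x) @ \oo --> fine (p A).
Proof.
move=> mD mA AD mf f1 fA.
have [] := @dominated_convergence _ T R p D mD (fun m x => (f m x)%:E)
  (fun x => (\1_A x)%:E) (fun=> 1%:E).
- by move=> m; apply/measurable_EFinP.
- by apply/measurable_EFinP; exact: measurable_indic.
- by apply: aeW => x Dx; apply/cvg_EFin; [exact: nearW|exact: fA].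
- exact: finite_measure_integrable_cst.
- by apply: aeW => x m _; rewrite lee_fin.
move=> _ _; rewrite integral_indic// (setIidl AD) => h.
by apply: fine_cvg; rewrite fineK ?fin_num_measure.
Qed.

Lemma charge_integral_cvg (nu : {charge set T -> \bar R}) (D A : set T)
    (f : nat -> T -> R) : measurable D -> measurable A -> A `<=` D ->
  (forall m, measurable_fun D (f m)) -> (forall m x, `|f m x| <= 1) ->
  (forall x, D x -> f ^~ x @ \oo --> (\1_A x : R)) ->
  (fun m => charge_integral nu D (f m)) @ \oo --> fine (nu A).
Proof.
move=> mD mA AD mf f1 fA; have [p [q [nuE intE]]] := charge_integral_jordan nu.
under eq_fun do rewrite intE.
rewrite nuE// fineB ?fin_num_measure//.
by apply: cvgB; exact: Rintegral_indic_cvg.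
Qed.

Lemma integrable_bounded (p : {finite_measure set T -> \bar R}) (D : set T)
    (f : T -> R) (C : R) : measurable D -> measurable_fun D f ->
  (forall x, `|f x| <= C) -> p.-integrable D (EFin \o f).
Proof.
move=> mD mf fC; apply: measurable_bounded_integrable => //.
  by rewrite ltey_eq fin_num_measure.
exists C; split; first by rewrite num_real.
by move=> M CM x _ /=; apply: le_trans (fC x) (ltW CM).
Qed.

Lemma integral_mscale (mu : {measure set T -> \bar R}) (c : {nonneg R}) (D : set T)
    (f : T -> \bar R) : measurable D -> mu.-integrable D f ->
  (\int[mscale c mu]_(x in D) f x = c%:num%:E * \int[mu]_(x in D) f x)%E.
Proof.
move=> mD intf; have mf := measurable_int _ intf.
rewrite [LHS]integralE [X in (_ * X)%E]integralE muleBr ?integrable_add_def//.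
congr (_ - _)%E.
  exact: (ge0_integral_mscale mu mD c (measurable_funepos mf) (fun x _ => funepos_ge0 f x)).
exact: (ge0_integral_mscale mu mD c (measurable_funeneg mf) (fun x _ => funeneg_ge0 f x)).
Qed.

(** The relation [p - q = c mu] in a form where only nonnegative measures occur. *)
Lemma Rintegral_add_scale (p q mu : {finite_measure set T -> \bar R})
    (c : {nonneg R}) (D : set T) (f : T -> R) (C : R) :
  measurable D -> measurable_fun D f -> (forall x, `|f x| <= C) ->
  (forall A, measurable A -> p A = q A + c%:num%:E * mu A)%E ->
  \int[p]_(x in D) f x = \int[q]_(x in D) f x + c%:num * \int[mu]_(x in D) f x.
Proof.
move=> mD mf fC pE.
have iq := integrable_bounded q mD mf fC.
have imu := integrable_bounded mu mD mf fC.
have imc : (mscale c mu).-integrable D (EFin \o f).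
  exact: (integrable_bounded _ mD mf fC).
rewrite /Rintegral (@eq_measure_integral _ _ _ _ (measure_add q (mscale c mu))).
  rewrite integral_measure_add// integral_mscale//.
  rewrite fineD ?fineM ?integrable_fin_num//.
  by rewrite fin_numM ?integrable_fin_num.
by move=> A mA _; exact: etrans (pE _ mA) (esym (measure_addE q (mscale c mu) A)).
Qed.

(** The Jordan decomposition of [c mu] is not computed. Only [p - q = c mu] is used, the sign of [c]
    deciding which of [p] and [q] is the other one plus a nonnegative multiple of [mu]. *)
Lemma charge_integral_scale (nu : {charge set T -> \bar R})
    (mu : {finite_measure set T -> \bar R}) (c : R) (D : set T) (f : T -> R) (C : R) :
  measurable D -> measurable_fun D f -> (forall x, `|f x| <= C) ->
  (forall A, measurable A -> nu A = c%:E * mu A)%E ->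
  charge_integral nu D f = c * \int[mu]_(x in D) f x.
Proof.
move=> mD mf fC nucE; have [p [q [nuE ->]]] := charge_integral_jordan nu.
have pq A : measurable A -> (p A = q A + c%:E * mu A)%E.
  by move=> mA; rewrite -nucE// nuE// addeC subeK ?fin_num_measure.
have [c0|c0] := leP 0 c.
  rewrite (@Rintegral_add_scale p q mu (NngNum c0) D f C)//=.
  by rewrite addrAC subrr add0r.
have Nc0 : 0 <= - c by rewrite oppr_ge0 ltW.
rewrite (@Rintegral_add_scale q p mu (NngNum Nc0) D f C)//=; first by ring.
move=> A mA; rewrite pq//= EFinN mulNe -addeA subee ?adde0//.
by rewrite fin_numM ?fin_num_measure.
Qed.

End ChargeIntegral.

(** * Test functions and integration by parts against linear fields *)

Section TestFunctions.
Variables (R : realType) (n : nat).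
Local Notation T := 'cV[R]_n.
Local Notation L := (@lebn R n).
Local Notation unitv j := (delta_mx j 0 : T).
Implicit Types (phi : T -> R) (Omega : set T).

Lemma partial_near0 phi x j : (\forall y \near x, phi y = 0) -> partial j phi x = 0.
Proof.
move=> phi0; rewrite /partial (@near_eq_derive _ _ _ phi (cst 0))//.
exact: derive_cst.
Qed.

Lemma vanish_off_partial r phi j : vanish_off r phi -> vanish_off r (partial j phi).
Proof.
move=> vphi x rx; apply: partial_near0.
have /open_nbhs_nbhs : open_nbhs x (~` @nball R n r).
  split; first by apply: closed_openC; exact: closed_nball.
  by rewrite /nball/=; apply/negP; rewrite -ltNge.
by apply: filterS => y /negP; rewrite -ltNge; exact: vphi.
Qed.

Lemma smooth_continuous phi : smooth phi -> continuous phi.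
Proof. by move=> /(_ [::])[]. Qed.

Lemma smooth_derivable phi j x : smooth phi -> derivable phi x (unitv j).
Proof. by move=> /(_ [::])[_]; exact. Qed.

Lemma smooth_continuous_partial phi j : smooth phi -> continuous (partial j phi).
Proof. by move=> /(_ [:: j])[]. Qed.

Lemma test_function_vanish_off Omega phi : test_function Omega phi ->
  exists r, vanish_off r phi.
Proof.
move=> [_ /compact_bounded/ex_strict_bound_gt0[r _ rS] _]; exists r => x rx.
apply/eqP; apply: contraTT isT => phix.
have : `|x| < r by apply: rS; exact: subset_closure.
by rewrite ltNge (ltW rx).
Qed.

Lemma test_function_out Omega phi x : test_function Omega phi -> ~ Omega x ->
  \forall y \near x, phi y = 0.
Proof.
move=> [_ _ sub] nOx.
have /open_nbhs_nbhs : open_nbhs x (~` closure [set x | phi x != 0]).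
  by split; [apply: closed_openC; exact: closed_closure|move=> /sub].
apply: filterS => y ny; apply/eqP; apply: contrapT => phiy; apply: ny.
by apply: subset_closure; apply/negP.
Qed.

Lemma Rintegral_eq0_out (D : set T) (f : T -> R) : (forall x, ~ D x -> f x = 0) ->
  \int[L]_(x in D) f x = \int[L]_x f x.
Proof.
move=> f0; rewrite Rintegral_mkcond; apply: eq_Rintegral => x _.
by rewrite patchE; case: ifPn => //; rewrite notin_setE => /f0.
Qed.

(** Evaluates the left side of [is_symgrad] once its two terms are integrated separately. *)
Lemma Rintegral_half_sum (D : set T) (f g : T -> R) (a b : R) : measurable D ->
  L.-integrable D (EFin \o f) /\ \int[L]_(x in D) f x = a ->
  L.-integrable D (EFin \o g) /\ \int[L]_(x in D) g x = b ->
  fine (\int[L]_(x in D) (2^-1 * (f x + g x))%:E) = 2^-1 * (a + b).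
Proof.
move=> mD [intf <-] [intg <-].
have intfg : L.-integrable D (EFin \o (fun x => f x + g x)).
  exact: (integrableD mD intf intg).
by have := RintegralZl 2^-1 mD intfg; rewrite (RintegralD mD intf intg).
Qed.

Lemma mulmx_coordE (xi : 'M[R]_n) i t j (x : T) :
  (xi *m (t *: unitv j + x)) i 0 = xi i j * t + (xi *m x) i 0.
Proof.
rewrite mulmxDr mxE; congr (_ + _).
by rewrite -scalemxAr mxE -colE mxE mulrC.
Qed.

Lemma is_derive_mulmx (xi : 'M[R]_n) i j (x : T) :
  is_derive x (unitv j) (fun y : T => (xi *m y) i 0) (xi i j).
Proof.
have := @is_derive_lineP R n (fun y : T => (xi *m y) i 0) x (unitv j) 0 (xi i j).
rewrite scale0r add0r => lineP; apply/lineP => {lineP}.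
rewrite (_ : (fun s : R => _) = fun s => xi i j * s + (xi *m x) i 0); last first.
  by apply/funext => s; exact: mulmx_coordE.
have := is_deriveD (is_deriveZ (xi i j) (is_derive_id (0 : R) (1 : R)))
  (is_derive_cst ((xi *m x) i 0) (0 : R) (1 : R)).
by rewrite addr0 [_%:A]mulr1.
Qed.

Lemma continuous_mulmx (xi : 'M[R]_n) i : continuous (fun y : T => (xi *m y) i 0).
Proof.
rewrite (_ : (fun y => _) = \sum_k (fun y : T => xi i k * y k 0)); last first.
  by apply/funext => y; rewrite mxE fct_sumE.
elim/big_ind: _ => [|f g cf cg|k _] y; first exact: cst_continuous.
  by apply: (@continuousD _ _ _ f g y (cf y) (cg y)).
apply: (@continuousM _ _ (cst (xi i k)) (fun y : T => y k 0)); first exact: cst_continuous.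
exact: coord_continuous.
Qed.

(** The product of the linear function and [phi] has compact support, so the integral of its partial
    derivative vanishes; expand by the product rule. *)
Lemma integral_mulmx_partial Omega phi (xi : 'M[R]_n) i j :
  test_function Omega phi ->
  L.-integrable setT (fun x => ((xi *m x) i 0 * partial j phi x)%:E) /\
  \int[L]_x ((xi *m x) i 0 * partial j phi x) = - (xi i j * \int[L]_x phi x).
Proof.
move=> tphi; have [sphi _ _] := tphi.
have [r vphi] := test_function_vanish_off tphi.
have cphi := smooth_continuous sphi.
have cdphi := smooth_continuous_partial (j := j) sphi.
have cxi : continuous (fun y : T => (xi *m y) i 0) by exact: continuous_mulmx.
pose g x := (xi *m x) i 0 * phi x.
have dg x : is_derive x (unitv j) g ((xi *m x) i 0 * partial j phi x + phi x * xi i j).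
  have dphi : is_derive x (unitv j) phi (partial j phi x).
    exact/derivableP/smooth_derivable.
  exact: (is_deriveM (is_derive_mulmx xi i j x) dphi).
have dgE : partial j g = fun x => (xi *m x) i 0 * partial j phi x + phi x * xi i j.
  by apply/funext => x; rewrite /partial; have [_ ->] := dg x.
have cg1 : continuous (fun x => (xi *m x) i 0 * partial j phi x).
  by move=> x; apply: (@continuousM _ _ _ _ x (cxi x) (cdphi x)).
have cg2 : continuous (fun x => phi x * xi i j).
  move=> x; apply: (@continuousM _ _ phi (cst (xi i j)) x (cphi x)).
  exact: cst_continuous.
have i1 : L.-integrable setT (EFin \o (fun x => (xi *m x) i 0 * partial j phi x)).
  apply: (integrable_continuous_vanish_off (r := r) cg1) => x rx.
  by rewrite (vanish_off_partial j vphi rx) mulr0.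
have i0 : L.-integrable setT (EFin \o phi).
  exact: integrable_continuous_vanish_off vphi.
have i2 : L.-integrable setT (EFin \o (fun x => phi x * xi i j)).
  apply: (integrable_continuous_vanish_off (r := r) cg2) => x rx.
  by rewrite (vphi _ rx) mul0r.
split => //.
have : \int[L]_x partial j g x = 0.
  apply: (@integral_partial_eq0 _ _ r).
  - by move=> x; apply: (@continuousM _ _ _ _ x (cxi x) (cphi x)).
  - by move=> x; have [] := dg x.
  - by rewrite dgE => x; apply: (@continuousD _ _ _ _ _ x (cg1 x) (cg2 x)).
  - by move=> x rx; rewrite /g vphi// mulr0.
  - by apply: vanish_off_partial => x rx; rewrite /g vphi// mulr0.
rewrite dgE RintegralD// RintegralZr// => /eqP; rewrite addr_eq0 => /eqP ->.
by rewrite mulrC.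
Qed.

End TestFunctions.

(** * Integrals against arbitrary set functions *)

Section IntegralSetFunction.
Context d (T : measurableType d) (R : realType).
Local Open Scope ereal_scope.
Import HBNNSimple.
Implicit Types (mu : set T -> \bar R) (f g : T -> \bar R) (D E : set T).

(** The supremum inside the library definition of the integral, isolated because its monotonicity in
    [f] requires nothing of [mu]. *)
Definition simple_sup mu f := ereal_sup [set sintegral mu h |
  h in [set h : {nnsfun T >-> R} | forall x, (h x)%:E <= f x]].

Lemma integral_simple_sup mu D f :
  integral mu D f = simple_sup mu ((f \_ D) ^\+) - simple_sup mu ((f \_ D) ^\-).
Proof. by []. Qed.

Lemma le_simple_sup mu f g : (forall x, f x <= g x) ->
  simple_sup mu f <= simple_sup mu g.
Proof.
move=> fg; apply: le_ereal_sup => _ [h hf <-]; exists h => // x.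
exact: le_trans (hf x) (fg x).
Qed.

Lemma sintegral_cst0 mu : mu set0 = 0 -> sintegral mu (cst 0%R : T -> R) = 0.
Proof.
move=> mu0; rewrite /sintegral fsbig1// => r _; rewrite preimage_cst.
by case: ifPn => [/[!inE] <-|_]; rewrite ?mul0e// mu0 mule0.
Qed.

Lemma simple_sup_ge0 mu f : mu set0 = 0 -> (forall x, 0 <= f x) ->
  0 <= simple_sup mu f.
Proof.
move=> mu0 f0; apply: ereal_sup_ubound; exists nnsfun0 => //=.
exact: sintegral_cst0.
Qed.

Lemma simple_sup0 mu : mu set0 = 0 -> simple_sup mu (cst 0) = 0.
Proof.
move=> mu0; apply/eqP; rewrite eq_le simple_sup_ge0// andbT.
apply: ge_ereal_sup => _ [h h0 <-].
rewrite (_ : (h : T -> R) = cst 0%R) ?sintegral_cst0//.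
by apply/funext => x; apply/eqP; rewrite eq_le -2!lee_fin h0/= lee_fin fun_ge0.
Qed.

Lemma ge0_integral_simple_sup mu D f : mu set0 = 0 -> (forall x, D x -> 0 <= f x) ->
  integral mu D f = simple_sup mu (f \_ D).
Proof.
move=> mu0 f0; rewrite integral_simple_sup.
have fD0 x : 0 <= (f \_ D) x.
  by rewrite patchE; case: ifPn => // /set_mem/f0.
rewrite (_ : (f \_ D)^\+ = f \_ D); last first.
  by apply/funext => x; rewrite funeposE; exact/max_idPl.
rewrite (_ : (f \_ D)^\- = cst 0) ?simple_sup0 ?sube0//.
by apply/funext => x; rewrite funenegE; apply/max_idPr; rewrite leeNl oppe0.
Qed.

Lemma ge0_le_integral_set_function mu D E f g : mu set0 = 0 ->
  (forall x, D x -> 0 <= f x) -> (forall x, E x -> 0 <= g x) ->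
  (forall x, D x -> E x /\ f x <= g x) -> integral mu D f <= integral mu E g.
Proof.
move=> mu0 f0 g0 fg; rewrite !ge0_integral_simple_sup//; apply: le_simple_sup => x.
rewrite !patchE; case: ifPn => [/set_mem/fg[Ex fgx]|_]; first by rewrite mem_set.
by case: ifPn => // /set_mem/g0.
Qed.

Lemma integral_set0_set_function mu f : mu set0 = 0 -> integral mu set0 f = 0.
Proof.
move=> mu0; rewrite ge0_integral_simple_sup// (_ : f \_ set0 = cst 0) ?simple_sup0//.
by apply/funext => x; rewrite patchE in_set0.
Qed.

(** Without additivity the integral of the absolute value cannot be split. Instead the integrals of
    the positive and negative parts each lie between 0 and that of [g], and so does the absolute
    value of their difference. *)
Lemma abse_integral_le_set_function mu D (f g : T -> R) : mu set0 = 0 ->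
  (forall x, D x -> `|f x| <= g x)%R ->
  `|integral mu D (EFin \o f)| <= integral mu D (EFin \o g).
Proof.
move=> mu0 fg.
have g0 x : D x -> 0 <= (EFin \o g) x.
  by move=> /fg; rewrite lee_fin; exact: le_trans.
rewrite integral_simple_sup (ge0_integral_simple_sup mu0 g0).
have le1 : simple_sup mu (((EFin \o f) \_ D)^\+) <= simple_sup mu ((EFin \o g) \_ D).
  apply: le_simple_sup => x; rewrite funeposE !patchE; case: ifPn => [/set_mem Dx|_].
    rewrite ge_max; apply/andP; split; last exact: g0.
    by rewrite /= lee_fin (le_trans (ler_norm _) (fg _ Dx)).
  by rewrite maxxx.
have le2 : simple_sup mu (((EFin \o f) \_ D)^\-) <= simple_sup mu ((EFin \o g) \_ D).
  apply: le_simple_sup => x; rewrite funenegE !patchE; case: ifPn => [/set_mem Dx|_].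
    rewrite ge_max; apply/andP; split; last exact: g0.
    by rewrite /= lee_fin (le_trans _ (fg _ Dx))// -normrN ler_norm.
  by rewrite oppe0 maxxx.
have p0 : 0 <= simple_sup mu (((EFin \o f) \_ D)^\+).
  by apply: simple_sup_ge0 => // x; exact: funepos_ge0.
have q0 : 0 <= simple_sup mu (((EFin \o f) \_ D)^\-).
  by apply: simple_sup_ge0 => // x; exact: funeneg_ge0.
move: (simple_sup mu _) (simple_sup mu _) (simple_sup mu _) p0 q0 le1 le2.
move=> [g'| |] [p| |] [q| |] //=; rewrite ?lee_fin ?leey//.
by move=> p0 q0 pg qg; rewrite ler_norml; apply/andP; split; lra.
Qed.

End IntegralSetFunction.

(** * The Hausdorff set function on the empty set *)

Section Hausdorff.
Variables (R : realType) (k n : nat).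

Lemma ediam_ge0 (A : set 'cV[R]_n) : 0 <= ediam A.
Proof.
rewrite /ediam; set S := (X in sup X).
have [[[s Ss] ubS]|nS] := pselect (has_sup S); last by rewrite sup_out.
apply: le_trans (ub_le_sup ubS Ss).
by case: Ss => x _ [y _ <-]; rewrite /enorm sqrtr_ge0.
Qed.

Lemma hausdorff_weight_ge0 (A : set 'cV[R]_n) : 0 <= hausdorff_weight k A.
Proof.
rewrite /hausdorff_weight; case: ifP => // _; apply: mulr_ge0.
  by rewrite /ball_volume fine_ge0// measure_ge0.
by rewrite exprn_ge0// divr_ge0// ediam_ge0.
Qed.

(** The cover by empty sets has weight 0, also for [k = 0] thanks to the special case in
    [hausdorff_weight]. *)
Lemma hausdorff0 : hausdorff k (set0 : set 'cV[R]_n) = 0%E.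
Proof.
have pre0 (delta : R) : hausdorff_pre k delta (set0 : set 'cV[R]_n) = 0%E.
  apply/eqP; rewrite eq_le; apply/andP; split; last first.
    apply/ereal_infP => _ [F _ <-]; apply: nneseries_ge0 => i _ _.
    by rewrite lee_fin hausdorff_weight_ge0.
  apply: ereal_inf_lbound; exists (fun=> set0); first by split.
  by rewrite eseries0// => i _ _; rewrite /hausdorff_weight asboolT.
rewrite /hausdorff (_ : [set _ | _ in _] = [set 0%E]) ?ereal_sup1//.
apply/seteqP; split => [_ [delta _ <-]|_ ->]; first by rewrite /= pre0.
by exists 1; [exact: ltr01|exact: pre0].
Qed.

End Hausdorff.

(** * Euclidean norm and scalar product of matrices *)

Section EuclideanNorm.
Variables (R : realType) (n : nat).
Local Notation T := 'cV[R]_n.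
Implicit Types x y : T.

Lemma mdot_colE x y : mdot x y = \sum_i x i 0 * y i 0.
Proof. by apply: eq_bigr => i _; rewrite big_ord1. Qed.

Lemma mdotr0 m p (M : 'M[R]_(m, p)) : mdot M 0 = 0.
Proof. by apply: big1 => i _; apply: big1 => j _; rewrite mxE mulr0. Qed.

Lemma mdot_ge0 m p (M : 'M[R]_(m, p)) : 0 <= mdot M M.
Proof. by apply: sumr_ge0 => i _; apply: sumr_ge0 => j _; rewrite -expr2 sqr_ge0. Qed.

Lemma enorm_sqr m p (M : 'M[R]_(m, p)) : enorm M ^+ 2 = mdot M M.
Proof. by rewrite sqr_sqrtr// mdot_ge0. Qed.

Lemma sqr_entry_le_mdot m p (M : 'M[R]_(m, p)) i j : M i j ^+ 2 <= mdot M M.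
Proof.
rewrite /mdot (bigD1 i)//= (bigD1 j)//= -expr2 -addrA lerDl addr_ge0//.
  by apply: sumr_ge0 => k _; rewrite -expr2 sqr_ge0.
by apply: sumr_ge0 => l _; apply: sumr_ge0 => k _; rewrite -expr2 sqr_ge0.
Qed.

Lemma entry_le_enorm m p (M : 'M[R]_(m, p)) i j : `|M i j| <= enorm M.
Proof. by rewrite -sqrtr_sqr ler_sqrt ?mdot_ge0// sqr_entry_le_mdot. Qed.

Lemma enorm_eq0 m p (M : 'M[R]_(m, p)) : enorm M = 0 -> M = 0.
Proof.
move=> M0; apply/matrixP => i j; rewrite mxE; apply/eqP; rewrite -normr_le0 -M0.
exact: entry_le_enorm.
Qed.

Lemma enorm_le_sum m p (M : 'M[R]_(m, p)) : enorm M <= \sum_i \sum_j `|M i j|.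
Proof.
have S0 : 0 <= \sum_i \sum_j `|M i j| by do 2!apply: sumr_ge0 => ? _.
rewrite -(ger0_norm S0) -sqrtr_sqr ler_sqrt ?sqr_ge0// expr2 mulr_suml.
apply: ler_sum => i _; rewrite mulr_suml; apply: ler_sum => j _.
apply: le_trans (ler_norm _) _; rewrite normrM ler_wpM2l//.
rewrite (bigD1 i)//= (bigD1 j)//= -addrA lerDl addr_ge0//; first exact: sumr_ge0.
by apply: sumr_ge0 => l _; exact: sumr_ge0.
Qed.

Lemma continuous_enorm_comp m p (S : topologicalType) (f : S -> 'M[R]_(m, p)) :
  (forall i j, continuous (fun z => f z i j)) -> continuous (fun z => enorm (f z)).
Proof.
move=> cf z; apply: (@continuous_comp _ _ _ (fun z => mdot (f z) (f z)) Num.sqrt);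
  last exact: sqrt_continuous.
rewrite (_ : (fun z => mdot (f z) (f z)) =
    \sum_i \sum_j (fun z => f z i j * f z i j)); last first.
  apply/funext => z'; rewrite /mdot fct_sumE; apply: eq_bigr => i _.
  by rewrite fct_sumE.
elim/big_ind: _ => [|g h cg ch|i _]; first exact: cst_continuous.
  by apply: (@continuousD _ _ _ g h z cg ch).
elim/big_ind: _ => [|g h cg ch|j _]; first exact: cst_continuous.
  by apply: (@continuousD _ _ _ g h z cg ch).
by apply: (@continuousM _ _ _ _ z (cf i j z) (cf i j z)).
Qed.

End EuclideanNorm.

(** * Continuous fields have no jump *)

Section ContinuousFields.
Variables (R : realType) (n : nat) (n_gt0 : (0 < n)%N).
Local Notation T := 'cV[R]_n.
Local Notation L := (@lebn R n).

(** A cube centred at [x + (r / 2) *: nu], which bounds the volume of the half ball from below by a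
    multiple of [r ^+ n] without computing it. *)
Lemma half_ball_contains_cbox (x nu : T) (r : R) : 0 < r -> enorm nu = 1 ->
  cbox (x + (r / 2) *: nu - const_mx (r / (4 * n%:R)))
       (x + (r / 2) *: nu + const_mx (r / (4 * n%:R))) `<=` half_ball x nu r.
Proof.
move=> r0 nu1 y yb; set s := r / (4 * n%:R) in yb.
have n0 : 1 <= n%:R :> R by rewrite ler1n.
have sE : n%:R * s = r / 4 by rewrite /s; field; rewrite pnatr_eq0 -lt0n.
have s0 : 0 < s by rewrite divr_gt0// mulr_gt0// (lt_le_trans ltr01 n0).
pose w : T := y - x - (r / 2) *: nu.
have ws i : `|w i 0| <= s.
  have := yb i; rewrite !mxE => /andP[? ?].
  by rewrite ler_norml; apply/andP; split; lra.
have nunu : \sum_i nu i 0 * nu i 0 = 1 by rewrite -mdot_colE -enorm_sqr nu1 expr1n.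
have yE i : (y - x) i 0 = r / 2 * nu i 0 + w i 0 by rewrite !mxE; ring.
split => /=.
  rewrite /eball/= -(@ltr_pXn2r _ 2)// ?nnegrE ?sqrtr_ge0 ?(ltW r0)//.
  rewrite enorm_sqr mdot_colE.
  (* Entrywise [(p + w)^2 <= 2 p^2 + 2 w^2] with [p = (r / 2) nu]. The total is [r^2 / 2 + r s / 2],
     at most [5 r^2 / 8]. *)
  apply: (@le_lt_trans _ _ (\sum_i (r ^+ 2 / 2 * (nu i 0 * nu i 0) + 2 * s ^+ 2))).
    apply: ler_sum => i _; rewrite yE.
    have : w i 0 ^+ 2 <= s ^+ 2 by rewrite -[w i 0 ^+ 2]real_normK ?num_real// lerXn2r// nnegrE ltW.
    have := sqr_ge0 (r / 2 * nu i 0 - w i 0); nra.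
  rewrite big_split/= -mulr_sumr nunu mulr1 sumr_const card_ord.
  rewrite -[(2 * s ^+ 2) *+ n]mulr_natl.
  have -> : n%:R * (2 * s ^+ 2) = r / 2 * s.
    transitivity (2 * (n%:R * s) * s); first by ring.
    by rewrite sE; field.
  have : s <= r / 4 by rewrite -sE ler_peMl// ltW.
  nra.
rewrite mdot_colE (eq_bigr (fun i => r / 2 * (nu i 0 * nu i 0) + w i 0 * nu i 0)); last first.
  by move=> i _; rewrite yE; ring.
rewrite big_split/= -mulr_sumr nunu mulr1.
(* The deviation contributes at most [n s = r / 4], less than the [r / 2] coming from the centre. *)
have : `|\sum_i w i 0 * nu i 0| <= \sum_(i < n) s.
  apply: le_trans (ler_norm_sum _ _ _) _; apply: ler_sum => i _.
  rewrite normrM -[leRHS]mulr1 ler_pM// -nu1; exact: entry_le_enorm.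
rewrite sumr_const card_ord -[s *+ n]mulr_natl sE ler_norml => /andP[h _]; lra.
Qed.

(** If [a] differed from [u x], then [enorm (u y - a)] would exceed a positive constant near [x],
    and the cube inside the half ball would keep the scaled integral away from 0. *)
Lemma one_sided_limit_continuous (u : T -> T) (x nu a : T) : continuous u ->
  enorm nu = 1 -> one_sided_limit u x nu a -> a = u x.
Proof.
move=> cu nu1 lim0; apply/eqP; rewrite eq_sym -subr_eq0; apply/eqP/enorm_eq0.
have [//|dn0] := eqVneq (enorm (u x - a)) 0; exfalso.
set d := enorm (u x - a) in dn0.
have d0 : 0 < d by rewrite lt_neqAle eq_sym dn0 sqrtr_ge0.
have ca : continuous (fun y => enorm (u y - a)).
  apply: continuous_enorm_comp => i j y.
  rewrite (_ : (fun z => (u z - a) i j) = (fun z => u z i j) - cst (a i j)); last first.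
    by apply/funext => z; rewrite !mxE.
  apply: continuousB; last exact: cst_continuous.
  by apply: (@continuous_comp _ _ _ u (fun M : T => M i j)); [exact: cu|exact: coord_continuous].
have /nbhs_ballP[rho /= rho0 rhod] : \forall y \near x, d / 2 < enorm (u y - a).
  by apply: (ca x [set t | d / 2 < t]); apply: lt_nbhsr; rewrite -/d; lra.
(* The cube has side [2 * (r / (4 * n%:R))] and volume [c * r ^+ n], which cancels the factor
   [r ^- n]. *)
pose c : R := (2 * (4 * n%:R)^-1) ^+ n.
have n0 : 0 < n%:R :> R by rewrite ltr0n.
have c0 : 0 < c by rewrite exprn_gt0// mulr_gt0// invr_gt0 mulr_gt0.
have lb r : 0 < r < rho -> ((d / 2 * c)%:E <= (r ^- n)%:E *
    \int[L]_(y in half_ball x nu r) (enorm (u y - a))%:E)%E.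
  move=> /andP[r0 rrho].
  set B1 := x + (r / 2) *: nu - const_mx (r / (4 * n%:R)).
  set B2 := x + (r / 2) *: nu + const_mx (r / (4 * n%:R)).
  have LB : L (cbox B1 B2) = (c * r ^+ n)%:E.
    rewrite lebn_cbox => [|i]; last first.
      rewrite !mxE lerD2l; have : 0 < r / (4 * n%:R) by rewrite divr_gt0// mulr_gt0.
    lra.
    congr EFin; rewrite (eq_bigr (fun=> r * (2 * (4 * n%:R)^-1))) => [|i _]; last first.
      by rewrite !mxE; ring.
    by rewrite prodr_const card_ord exprMn mulrC.
  have -> : (d / 2 * c)%:E = ((r ^- n)%:E * ((d / 2)%:E * L (cbox B1 B2)))%E.
    by rewrite LB -!EFinM; congr EFin; field; rewrite gt_eqF// exprn_gt0.
  apply: lee_wpmul2l; first by rewrite lee_fin invr_ge0 exprn_ge0// ltW.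
  rewrite -integral_cst; last exact: measurable_cbox.
  apply: ge0_le_integral_set_function => [||y _|y /half_ball_contains_cbox].
  - exact: measure0.
  - by move=> y _; rewrite lee_fin; lra.
  - by rewrite lee_fin sqrtr_ge0.
  move=> /(_ r0 nu1) yr; split=> //; rewrite lee_fin; apply/ltW/rhod.
  rewrite mx_norm_ball /ball_/= distrC; apply: le_lt_trans rrho.
  apply: mx_norm_le => [|i j]; first exact: ltW.
  rewrite ord1; apply: le_trans (entry_le_enorm _ _ _) _.
  by case: yr => /ltW.
have : \forall r \near 0^'+, ((r ^- n)%:E *
    \int[L]_(y in half_ball x nu r) (enorm (u y - a))%:E < (d / 2 * c)%:E)%E.
  apply: (lim0 [set z | (z < (d / 2 * c)%:E)%E]); apply: open_nbhs_nbhs; split; first exact: open_ereal_lt_ereal.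
  by rewrite /= lte_fin mulr_gt0//; lra.
move=> h; have /filter_ex[r [rlt r0 rr]] : \forall r \near 0^'+, [/\
    ((r ^- n)%:E * \int[L]_(y in half_ball x nu r) (enorm (u y - a))%:E <
      (d / 2 * c)%:E)%E, 0 < r & r < rho].
  near=> r; split; near: r; first exact: h.
    exact: nbhs_right_gt.
  exact: nbhs_right_lt.
have := le_lt_trans (lb r _) rlt; rewrite ltxx => /(_ _)/negP[]//.
exact/andP.
Unshelve. all: by end_near. Qed.

Lemma jump_set_continuous (u : T -> T) : continuous u -> jump_set u = set0.
Proof.
move=> cu; apply/seteqP; split => // x [[[a b] nu] [/eqP ab nu1 la lb]]; apply: ab.
rewrite (one_sided_limit_continuous cu nu1 la).
apply/esym/(one_sided_limit_continuous cu _ lb).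
by rewrite -nu1 /enorm /mdot; congr Num.sqrt; apply: eq_bigr => i _;
   apply: eq_bigr => j _; rewrite !mxE mulrNN.
Qed.

End ContinuousFields.

(** * Linear fields belong to SBD *)

Section LinearFields.
Variables (R : realType) (n : nat) (n_gt0 : (0 < n)%N).
Local Notation T := 'cV[R]_n.
Local Notation L := (@lebn R n).

Lemma continuous_mulmx_vec (xi : 'M[R]_n) : continuous (fun x : T => xi *m x).
Proof. by apply: continuous_to_mx => i j; rewrite ord1; exact: continuous_mulmx. Qed.

Lemma bounded_nball (Omega : set T) : bounded_set Omega ->
  exists r, Omega `<=` nball r.
Proof. by move=> /ex_strict_bound_gt0[r _ Or]; exists r => x /Or/ltW. Qed.

Lemma bounded_lebn_lty (Omega : set T) : measurable Omega -> bounded_set Omega ->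
  (L Omega < +oo)%E.
Proof.
move=> mO /bounded_nball[r Or]; apply: le_lt_trans (lebn_nball_lty n r).
by apply: le_measure; rewrite ?inE//; exact: measurable_nball.
Qed.

(** The symmetrized gradient is [xi] times Lebesgue measure on [Omega], a finite measure because
    [Omega] is bounded; the singular part is zero because there is no jump. *)
Lemma SBD_linear (Omega : set T) (xi : 'M[R]_n) : sym_mx xi ->
  open Omega -> bounded_set Omega -> SBD Omega (fun x => xi *m x) (fun=> xi).
Proof.
move=> sxi oO bO.
have mO : measurable Omega := open_measurable_mx oO.
have LO := bounded_lebn_lty mO bO.
have J0 : jump_set (fun x : T => xi *m x) = set0.
  by apply: jump_set_continuous => //; exact: continuous_mulmx_vec.
pose mu : {finite_measure set T -> \bar R} := mfrestr mO LO.
pose Eu i j : {charge set T -> \bar R} := cscale (xi i j) (charge_of_finite_measure mu).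
exists Eu, (fun _ _ => czero); split.
- split.
    move=> i; apply: measurable_bounded_integrable => //.
      by apply: measurable_funTS; apply: continuous_measurable_mx; exact: continuous_mulmx.
    have [r Or] := bounded_nball bO.
    have /ex_strict_bound_gt0[C C0 OC] :
        bounded_set ((fun x : T => (xi *m x) i 0) @` nball r).
      apply: compact_bounded; apply: continuous_compact; last exact: compact_nball.
      by apply: continuous_subspaceT; exact: continuous_mulmx.
    exists C; split; first by rewrite num_real.
    move=> D CD x Ox /=; apply: le_trans (ltW CD); apply/ltW/OC.
    by exists x => //; exact: Or.
  move=> phi tphi i j.
  have [sphi _ suppO] := tphi.
  have [r vphi] := test_function_vanish_off tphi.
  have [C C0 phiC] := vanish_off_bounded (smooth_continuous sphi) vphi.
  have phi0 x : ~ Omega x -> phi x = 0.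
    by move=> /(test_function_out tphi); exact: nbhs_singleton.
  have dphi0 k x : ~ Omega x -> partial k phi x = 0.
    by move=> /(test_function_out tphi)/partial_near0; exact.
  have mphi : measurable_fun Omega phi.
    apply: measurable_funTS; apply: continuous_measurable_mx; exact: smooth_continuous.
  rewrite (@charge_integral_scale _ _ _ (Eu i j) mu (xi i j) Omega phi C)//.
  have -> : \int[mu]_(x in Omega) phi x = \int[L]_x phi x.
    rewrite -(Rintegral_eq0_out phi0); congr fine.
    by apply: eq_measure_integral => A mA AO; rewrite /mu/=/mfrestr/mrestr setIidl.
  have I k l : L.-integrable Omega (EFin \o (fun x => (xi *m x) k 0 * partial l phi x)) /\
      \int[L]_(x in Omega) ((xi *m x) k 0 * partial l phi x) = - (xi k l * \int[L]_x phi x).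
    have [ikl Ikl] := integral_mulmx_partial xi k l tphi.
    split; first exact: (integrableS measurableT mO (@subsetT _ _) ikl).
    by rewrite -Ikl; apply: Rintegral_eq0_out => x Ox; rewrite dphi0// mulr0.
  rewrite (Rintegral_half_sum mO (I i j) (I j i)).
  (* Integration by parts yields the symmetric part of [xi], which is [xi] itself. *)
  have -> : xi j i = xi i j by rewrite -[in LHS]sxi mxE.
  by field.
- split.
  + by move=> i j; apply: measurable_bounded_integrable => //; exists `|xi i j|;
      split; rewrite ?num_real// => M hM x _ /=; apply: ltW.
  + move=> i j A mA AO; rewrite adde0 integral_cst//.
    by rewrite /= /cscale /charge_of_finite_measure/= /mu/= /mfrestr /mrestr setIidl.
  + by exists set0; split=> //; exact: measure0.
- move=> i j; rewrite J0 setI0; apply/integrableP; split.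
    by move=> _ Y mY; rewrite set0I.
  by rewrite integral_set0_set_function// hausdorff0.
- by move=> i j A mA AO; rewrite J0 setI0 integral_set0_set_function// hausdorff0.
Qed.

End LinearFields.

(** * The upper bound, from the energy of the linear field *)

Section UpperBound.
Variables (R : realType) (n : nat) (n_gt0 : (0 < n)%N).
Local Notation T := 'cV[R]_n.
Local Notation L := (@lebn R n).
Variable A : {linear 'M[R]_n -> 'M[R]_n}.

Lemma mdot_linear_le : exists2 C, 0 < C & forall xi, mdot (A xi) xi <= C * enorm xi ^+ 2.
Proof.
(* The sum of the absolute values of all coefficients of [A] in the basis of matrix units; 1 is
   added afterwards to have a positive constant. *)
pose C := \sum_(k < n) \sum_(l < n) \sum_(i < n) \sum_(j < n) `|A (delta_mx i j) k l|.
have C0 : 0 <= C by do 4!apply: sumr_ge0 => ? _.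
exists (C + 1) => [|xi]; first by lra.
have e0 : 0 <= enorm xi by rewrite sqrtr_ge0.
apply: (@le_trans _ _ (C * enorm xi ^+ 2)); last first.
  by rewrite ler_wpM2r ?sqr_ge0//; lra.
rewrite /C mulr_suml; apply: ler_sum => k _; rewrite mulr_suml; apply: ler_sum => l _.
apply: le_trans (ler_norm _) _; rewrite normrM expr2 mulrA ler_pM//; last first.
  exact: entry_le_enorm.
rewrite {1}(matrix_sum_delta xi) linear_sum summxE mulr_suml.
apply: le_trans (ler_norm_sum _ _ _) _; apply: ler_sum => i _.
rewrite linear_sum summxE mulr_suml.
apply: le_trans (ler_norm_sum _ _ _) _; apply: ler_sum => j _.
by rewrite linearZ mxE normrM mulrC ler_wpM2l// entry_le_enorm.
Qed.

Hypothesis HA : posdef_sym_operator A.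

Lemma mdot_posdef_ge0 xi : sym_mx xi -> 0 <= mdot (A xi) xi.
Proof.
have [_ _ Apos] := HA => sxi; have [->|xi0] := eqVneq xi 0.
  by rewrite mdotr0.
exact/ltW/Apos.
Qed.

Lemma Anorm_sqr xi : sym_mx xi -> Anorm A xi ^+ 2 = mdot (A xi) xi.
Proof. by move=> sxi; rewrite sqr_sqrtr// mdot_posdef_ge0. Qed.

Lemma unit_cellE : @unit_cell R n = obox 0 (const_mx 1).
Proof. by apply/seteqP; split => x h i; have := h i; rewrite !mxE. Qed.

Lemma half_open_cellE : @half_open_cell R n = cbox 0 (const_mx 1).
Proof. by apply/seteqP; split => x h i; have := h i; rewrite !mxE. Qed.

Lemma lebn_unit_cell : L (@unit_cell R n) = 1%E.
Proof.
rewrite unit_cellE lebn_obox => [|i]; last by rewrite !mxE ler01.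
by rewrite big1// => i _; rewrite !mxE subr0.
Qed.

Lemma lebn_half_open_cell : L (@half_open_cell R n) = 1%E.
Proof.
rewrite half_open_cellE lebn_cbox => [|i]; last by rewrite !mxE ler01.
by rewrite big1// => i _; rewrite !mxE subr0.
Qed.

Lemma measurable_unit_cell : measurable (@unit_cell R n).
Proof. by rewrite unit_cellE; apply: open_measurable_mx; exact: open_obox. Qed.

Lemma measurable_half_open_cell : measurable (@half_open_cell R n).
Proof. by rewrite half_open_cellE; exact: measurable_cbox. Qed.

Lemma f_hom_le_quadratic (B : set T) (K0 : set 'M[R]_n) (xi : 'M[R]_n) : sym_mx xi ->
  (f_hom A B K0 xi <= (2^-1 * mdot (A xi) xi)%:E)%E.
Proof.
move=> sxi; apply: ereal_inf_lbound.
have J0 : jump_set (fun x : T => xi *m x) = set0.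
  by apply: jump_set_continuous => //; exact: continuous_mulmx_vec.
exists (fun x => xi *m x), (fun=> xi); split; first split.
- by move=> Omega oO bO; exact: SBD_linear.
- by rewrite J0.
- by exists set0; split=> //; [exact: hausdorff0|rewrite J0 => x /=; apply].
- move=> k; apply: aeW => x; rewrite !subrr//.
rewrite /cell_energy J0 set0I integral_set0_set_function ?hausdorff0// adde0.
rewrite integral_cst; last exact: measurable_unit_cell.
by rewrite [X in (_ * (_ * X))%E]lebn_unit_cell mule1 Anorm_sqr.
Qed.

End UpperBound.

(** * Integrals of a quasi-periodic function against a telescoping difference *)

Section TranslationDifference.
Variables (R : realType) (n : nat).
Local Notation T := 'cV[R]_n.
Local Notation L := (@lebn R n).
Local Notation unitv j := (delta_mx j 0 : T).

(** Shift the second term by [unitv j] and use the relation for [f]: the terms in [f] cancel and the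
    increment [c] remains. *)
Lemma Rintegral_translate_diff (j : 'I_n) (psi : T -> R) (Omega : set T)
    (f : T -> R) (c : R) : continuous psi -> vanish_off 1 psi ->
  measurable Omega -> nball 2 `<=` Omega -> L.-integrable Omega (EFin \o f) ->
  {ae L, forall x, f (x + unitv j) = f x + c} ->
  L.-integrable Omega (fun x => (f x * (psi x - psi (x - unitv j)))%:E) /\
  \int[L]_(x in Omega) (f x * (psi x - psi (x - unitv j))) = - (c * \int[L]_x psi x).
Proof.
move=> cpsi vpsi mO BO intf per.
have [C C0 psiC] := vanish_off_bounded cpsi vpsi.
have mpsi : measurable_fun setT psi.
  by apply: continuous_measurable_mx.
(* Extension by zero, so that translation invariance on the whole space applies. *)
pose w := f \_ Omega.
have wE : EFin \o w = (EFin \o f) \_ Omega.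
  by apply/funext => x; rewrite /w/= !patchE; case: ifP.
have intw : L.-integrable setT (EFin \o w) by rewrite wE; apply/(integrable_mkcond _ mO).
have mw : measurable_fun setT w by apply/measurable_EFinP; exact: measurable_int intw.
have e1' : `|unitv j| <= 1.
  by apply: mx_norm_le => // k l; rewrite mxE; case: (_ && _); rewrite ?normr1 ?normr0.
have int1 : L.-integrable setT (EFin \o (fun x => w x * psi x)).
  apply: (integrableMl measurableT intw mpsi).
  by exists C; split; rewrite ?num_real// => D CD x _; apply: le_trans (ltW CD).
have mpsi' : measurable_fun setT (fun x : T => psi (x - unitv j)).
  by apply: (measurableT_comp mpsi); exact: measurable_translate.
have int2 : L.-integrable setT (EFin \o (fun x => w x * psi (x - unitv j))).
  apply: (integrableMl measurableT intw mpsi').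
  by exists C; split; rewrite ?num_real// => D CD x _; apply: le_trans (ltW CD).
have int3 : L.-integrable setT (EFin \o psi).
  exact: integrable_continuous_vanish_off cpsi vpsi.
have int4 : L.-integrable setT (EFin \o (fun x => c * psi x)).
  by have := integrableZl measurableT c int3.
have restrE : (fun x => f x * (psi x - psi (x - unitv j))) \_ Omega =
    (fun x => w x * psi x - w x * psi (x - unitv j)).
  apply/funext => x; rewrite /w !patchE.
  by case: (x \in Omega); [exact: mulrBr|rewrite !mul0r subr0].
split.
  apply/(integrable_mkcond _ mO).
  rewrite (_ : _ \_ _ = EFin \o ((fun x => f x * (psi x - psi (x - unitv j))) \_ Omega)); last first.
    by rewrite -restrict_EFin.
  rewrite restrE; exact: (integrableB measurableT int1 int2).
rewrite Rintegral_mkcond restrE (RintegralB measurableT int1 int2).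
have -> : \int[L]_x (w x * psi (x - unitv j)) = \int[L]_x (w x * psi x + c * psi x).
  have mf2 : measurable_fun setT (EFin \o (fun x => w x * psi (x - unitv j))).
    exact: (measurable_int _ int2).
  rewrite /Rintegral -(integral_translate (unitv j) mf2); congr fine.
  apply: ae_eq_integral => //.
  - apply: (measurableT_comp mf2); exact: measurable_translate.
  - apply/measurable_EFinP; apply: measurable_funD.
      exact: measurable_funM.
    exact: measurable_funM.
  (* Only [x] in the support of [psi] matters; then [x] and [x + unitv j] both lie in [nball 2],
     where [w] is [f]. *)
  - apply: filterS per => x perx _ /=; rewrite addrK.
    have [x1|x1] := leP `|x| 1; last by rewrite vpsi// !mulr0 addr0.
    rewrite /w !patchE !mem_set ?perx ?mulrDl//; apply: BO; rewrite /nball/=.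
      by apply: le_trans x1 _; rewrite ler1n.
    by apply: le_trans (ler_normD _ _) _; rewrite [leRHS]mulr2n lerD.
rewrite (RintegralD measurableT int1 int4) (RintegralZl c measurableT int3); ring.
Qed.

End TranslationDifference.

(** * The cutoff of the unit cell and its partial derivatives *)

Section CutoffIntegral.
Variables (R : realType) (n : nat).
Local Notation T := 'cV[R]_n.
Local Notation L := (@lebn R n).
Local Notation unitv j := (delta_mx j 0 : T).
Variables (e : R) (e0 : 0 < e) (e1 : e <= 1) (j : 'I_n).

Local Notation phi := (box_cutoff e (0 : T) (const_mx 1)).

(** The cutoff with its bump in direction [j] replaced by a single ramp. Its support is unbounded in
    that direction, but that of its [j]-th partial derivative is not. *)
Definition half_cutoff (x : T) : R :=
  ramp e 0 (x j 0) * \prod_(l | l != j) bump e 0 1 (x l 0).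

Local Notation psi := (partial j half_cutoff).

Lemma smooth_expr_half_cutoff : smooth_expr half_cutoff.
Proof.
apply: SmoothMul; first exact: smooth_expr_ramp.
by apply: smooth_expr_prod => l _; apply: smooth_expr_sub; exact: smooth_expr_ramp.
Qed.

(* The cutoff telescopes along each coordinate; this is what makes the
   periodic part of a field invisible to its derivative. *)
Lemma box_cutoffE x : phi x = half_cutoff x - half_cutoff (x - unitv j).
Proof.
rewrite /box_cutoff /half_cutoff (bigD1 j)//= !mxE eqxx mulr1n.
rewrite [X in _ - _ * X](eq_bigr (fun l => bump e 0 1 (x l 0))) => [|l lj]; last first.
  by rewrite !mxE (negbTE lj) subr0.
rewrite -mulrBl; congr (_ * _).
  by have := rampB1 e 0 (x j 0); rewrite /bump add0r => ->.
by apply: eq_bigr => l _; rewrite !mxE.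
Qed.

Lemma partial_box_cutoff x : partial j phi x = psi x - psi (x - unitv j).
Proof.
have dh y : is_derive y (unitv j) half_cutoff (psi y).
  apply/derivableP; apply: smooth_derivable.
  exact/smooth_expr_smooth/smooth_expr_half_cutoff.
have dt : is_derive x (unitv j) (fun y => half_cutoff (y - unitv j)) (psi (x - unitv j)).
  have [dv dl] := dh (x - unitv j).
  have E : (fun h : R => h^-1 *: (((fun y => half_cutoff (y - unitv j)) \o shift x)
      (h *: unitv j) - half_cutoff (x - unitv j))) =
      (fun h : R => h^-1 *: ((half_cutoff \o shift (x - unitv j)) (h *: unitv j) -
        half_cutoff (x - unitv j))).
    by apply/funext => h /=; rewrite addrA.
  apply: DeriveDef; first by rewrite /derivable E; exact: dv.
  by rewrite /derive E; exact: dl.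
rewrite /partial (_ : phi = half_cutoff - (fun y => half_cutoff (y - unitv j))).
  by have [_ ->] := is_deriveB (dh x) dt.
by apply/funext => y; rewrite box_cutoffE.
Qed.

Lemma continuous_psi : continuous psi.
Proof.
apply: smooth_continuous_partial.
exact/smooth_expr_smooth/smooth_expr_half_cutoff.
Qed.

Lemma near_coord (P : R -> Prop) (x : T) l :
  (\forall t \near x l 0, P t) -> \forall y \near x, P ((y : T) l 0).
Proof. exact: (@coord_continuous R n 1 l 0 x). Qed.

(** Some coordinate exceeds 1 in absolute value. If it is not the [j]-th, its bump vanishes nearby
    since [e <= 1]. If it is, the ramp is locally 0 on the left, and locally 1 on the right, where
    [half_cutoff] does not depend on the [j]-th coordinate. *)
Lemma psi_vanish : vanish_off 1 psi.
Proof.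
move=> x x1.
have [l xl] : exists l, 1 < `|x l 0|.
  apply: contrapT => /forallNP xl; move: x1; rewrite ltNge => /negP; apply.
  by apply: mx_norm_le => // i k; rewrite ord1 leNgt; apply/negP.
have near1 : \forall y \near x, (y : T) l 0 < -1 \/ 1 < (y : T) l 0.
  apply: (near_coord (P := fun t => t < -1 \/ 1 < t)); move: xl; rewrite ltr_normr => /orP[xl|xl].
    by near=> t; right; near: t; exact: lt_nbhsr.
  near=> t; left; near: t; apply: lt_nbhsl; lra.
have [lj|lj] := eqVneq l j; last first.
  apply: partial_near0; apply: filterS near1 => y yl.
  rewrite /half_cutoff (bigD1 l)//= bump0 ?mul0r ?mulr0//.
  rewrite negb_and -!leNgt sub0r; apply/orP; case: yl => yl; [left|right; exact: ltW].
  by apply: le_trans (ltW yl) _; rewrite lerN2.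
rewrite lj {l lj} in xl near1.
have [xj|xj] := ltP (x j 0) 0.
  apply: partial_near0.
  have near0 : \forall y \near x, (y : T) j 0 < 0 by
    apply: (near_coord (P := fun t => t < 0)); exact: lt_nbhsl.
  apply: filterS2 near1 near0 => y [yj|yj] yj0; last first.
    by have := lt_trans yj yj0; rewrite ltr10.
  rewrite /half_cutoff ramp0 ?mul0r// sub0r.
  by apply: le_trans (ltW yj) _; rewrite lerN2.
pose P (y : T) := \prod_(l | l != j) bump e 0 1 (y l 0).
rewrite /partial (@near_eq_derive _ _ _ half_cutoff P).
  have : is_derive x (unitv j) P 0.
    have := @is_derive_lineP R n P x (unitv j) 0 0.
    rewrite scale0r add0r => lineP; apply/lineP.
    rewrite (_ : (fun s : R => _) = cst (P x)); first exact: is_derive_cst.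
    apply/funext => s; apply: eq_bigr => l lj.
    by rewrite !mxE (negbTE lj) mulr0 add0r.
  by case.
have near0 : \forall y \near x, -1 < (y : T) j 0 by
  apply: (near_coord (P := fun t => -1 < t)); apply: lt_nbhsr; lra.
apply: filterS2 near1 near0 => y [yj|yj] yj0.
  by have := lt_trans yj0 yj; rewrite ltxx.
by rewrite /half_cutoff ramp1 ?mul1r// ltW// (lt_trans ltr01 yj).
Unshelve. all: by end_near. Qed.

Lemma Rintegral_partial_box_cutoff (Omega : set T) (f : T -> R) (c : R) :
  measurable Omega -> nball 2 `<=` Omega -> L.-integrable Omega (EFin \o f) ->
  {ae L, forall x, f (x + unitv j) = f x + c} ->
  L.-integrable Omega (fun x => (f x * partial j phi x)%:E) /\
  \int[L]_(x in Omega) (f x * partial j phi x) = - (c * \int[L]_x psi x).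
Proof.
rewrite (_ : partial j phi = fun x => psi x - psi (x - unitv j)).
  exact: Rintegral_translate_diff continuous_psi psi_vanish.
by apply/funext => x; exact: partial_box_cutoff.
Qed.

(** The integral of [x j 0 * partial j phi x] computed twice: integration by parts gives minus the
    integral of [phi], telescoping with increment 1 gives minus that of [psi]. *)
Lemma Rintegral_psi : \int[L]_x psi x = \int[L]_x phi x.
Proof.
have tphi : test_function setT phi.
  by apply: test_function_box_cutoff => // i; rewrite !mxE.
have [_] := @integral_mulmx_partial R n setT phi 1%:M j j tphi.
pose Omega := nball (R := R) (n := n) 2.
have intx : L.-integrable Omega (EFin \o (fun x : T => (1%:M *m x) j 0)).
  apply: measurable_bounded_integrable.
  - exact: measurable_nball.
  - exact: lebn_nball_lty.
  - by apply: measurable_funTS; apply: continuous_measurable_mx; exact: continuous_mulmx.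
  exists 2; split; rewrite ?num_real// => D D2 x Ox /=; rewrite mul1mx.
  by apply: le_trans (mx_norm_entry_le _ _ _) _; apply: le_trans Ox (ltW D2).
have per : {ae L, forall x : T, (1%:M *m (x + unitv j)) j 0 = (1%:M *m x) j 0 + 1}.
  by apply: aeW => x; rewrite !mul1mx !mxE !eqxx.
have [_] := Rintegral_partial_box_cutoff (@measurable_nball R n 2) (@subset_refl _ _) intx per.
rewrite mul1r Rintegral_eq0_out => [->|x Ox]; last first.
  rewrite partial_box_cutoff !psi_vanish ?subrr ?mulr0//.
    have e1' : `|unitv j| <= 1.
      by apply: mx_norm_le => // k l; rewrite mxE; case: (_ && _); rewrite ?normr1 ?normr0.
    have := ler_normD (x - unitv j) (unitv j); rewrite subrK.
    by move: Ox; rewrite /nball/= => /negP; rewrite -ltNge; lra.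
  by move: Ox; rewrite /nball/= => /negP; rewrite -ltNge; lra.
by rewrite mxE eqxx mul1r => /oppr_inj.
Qed.

End CutoffIntegral.

(** * Measures with a density, and functions with zero integral on boxes *)

Definition density_measure d (T : measurableType d) (R : realType)
    (mu : {measure set T -> \bar R}) (f : T -> \bar R)
    & measurable_fun setT f & (forall x, (0 <= f x)%E) :=
  fun A => (\int[mu]_(x in A) f x)%E.

Section DensityMeasure.
Context d (T : measurableType d) (R : realType) (mu : {measure set T -> \bar R}).
Variables (f : T -> \bar R) (mf : measurable_fun setT f) (f0 : forall x, (0 <= f x)%E).
Local Notation density_measure := (density_measure mu mf f0).

Let density_measure0 : density_measure set0 = 0%E.
Proof. exact: integral_set0. Qed.

Let density_measure_ge0 A : (0 <= density_measure A)%E.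
Proof. by apply: integral_ge0 => x _. Qed.

Let density_measure_sigma_additive : semi_sigma_additive density_measure.
Proof. exact: semi_sigma_additive_nng_induced. Qed.

HB.instance Definition _ := isMeasure.Build _ _ _ density_measure
  density_measure0 density_measure_ge0 density_measure_sigma_additive.

End DensityMeasure.

Section Boxes.
Variables (R : realType) (n : nat).
Local Notation T := 'cV[R]_n.
Local Notation L := (@lebn R n).

Lemma cboxI (a b c d : T) : cbox a b `&` cbox c d =
  cbox (\col_i Num.max (a i 0) (c i 0)) (\col_i Num.min (b i 0) (d i 0)).
Proof.
apply/seteqP; split => [x [ab cd] i|x abcd].
  rewrite !mxE ge_max lt_min; have /andP[-> ->] := ab i.
  by have /andP[-> ->] := cd i.
by split => i; have := abcd i; rewrite !mxE ge_max lt_min;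
  case/andP => /andP[? ?] /andP[? ?]; apply/andP.
Qed.

Definition boxes : set (set T) := [set B | exists a b, B = cbox a b].

(** Every open set is a countable union of rational boxes, which are half-open. *)
Lemma measurable_boxesE : @measurable _ 'cV[R]_n = <<s boxes >>.
Proof.
apply/seteqP; split.
  apply: smallest_sub; first exact: smallest_sigma_algebra.
  move=> U oU.
  pose F p := if `[< @rat_box R n 1 p `<=` U >] then @rat_box R n 1 p else set0.
  have -> : U = \bigcup_p F p.
    apply/seteqP; split => [x Ux|x [p _]]; rewrite /F; last first.
      by case: asboolP => // pU px; exact: pU.
    have [p [px pU]] := open_rat_box oU Ux.
    by exists p => //; rewrite /F; case: asboolP.
  apply: (@countable_bigcupT_measurable _ (g_sigma_algebraType boxes)).
    exact: countableP.
  move=> p; rewrite /F; case: asboolP => // _.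
  apply: sub_sigma_algebra.
  exists (\col_i (ratr (p.1 i 0) - ratr p.2)), (\col_i (ratr (p.1 i 0) + ratr p.2)).
  apply/seteqP; split => x px i; first by rewrite !mxE; have := px i 0; rewrite in_itv.
  by move=> j; rewrite ord1 in_itv/=; have := px i; rewrite !mxE.
apply: smallest_sub.
  exact: sigma_algebra_measurable.
by move=> _ [a [b ->]]; exact: measurable_cbox.
Qed.

Lemma bigcup_cboxT : \bigcup_k cbox (const_mx (- k%:R) : T) (const_mx k%:R) = setT.
Proof.
apply/seteqP; split => // x _; pose k := (Num.truncn `|x|).+1.
have xk : `|x| < k%:R by rewrite /k truncnS_gt.
exists k => // i; rewrite !mxE; have := mx_norm_entry_le x i 0.
rewrite ler_norml => /andP[h1 h2]; apply/andP; split.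
  by apply: le_trans h1; rewrite lerN2 ltW.
exact: le_lt_trans h2 xk.
Qed.

(** The positive and negative parts of [h] are densities of two finite measures that agree on boxes.
    Boxes are stable under intersection and generate the Borel sets, so the measures coincide and
    the two parts agree almost everywhere. *)
Lemma box_integral_eq0_ae (c d : T) (h : T -> R) :
  L.-integrable (cbox c d) (EFin \o h) ->
  (forall a b, \int[L]_(x in cbox a b `&` cbox c d) (h x)%:E = 0)%E ->
  {ae L, forall x, cbox c d x -> h x = 0}.
Proof.
set D := cbox c d => inth h0; have mD : measurable D := measurable_cbox c d.
pose g := (EFin \o h) \_ D.
have intg : L.-integrable setT g by apply/(integrable_mkcond _ mD).
have mg := measurable_int _ intg.
pose m1 := density_measure L (measurable_funepos mg) (funepos_ge0 g).
pose m2 := density_measure L (measurable_funeneg mg) (funeneg_ge0 g).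
have fin1 A : measurable A -> m1 A \is a fin_num.
  move=> mA; apply: integrable_fin_num => //; apply: integrable_funepos => //.
  exact: integrableS intg.
have fin2 A : measurable A -> m2 A \is a fin_num.
  move=> mA; apply: integrable_fin_num => //; apply: integrable_funeneg => //.
  exact: integrableS intg.
have m12 A : measurable A -> m1 A = m2 A.
  apply: (@measure_unique _ R _ boxes
    (fun k => cbox (const_mx (- k%:R) : T) (const_mx k%:R)) measurable_boxesE).
  - move=> _ _ [a1 [b1 ->]] [a2 [b2 ->]]; rewrite cboxI.
    by eexists; eexists.
  - by move=> k; eexists; eexists.
  - exact: bigcup_cboxT.
  - move=> _ [a [b ->]]; have mab := measurable_cbox a b.
    have E : (m1 (cbox a b) - m2 (cbox a b) = 0)%E.
      by rewrite -(h0 a b) integral_mkcondr [RHS]integralE.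
    by rewrite -[LHS](subeK _ (fin2 _ mab)) E add0e.
  - by move=> k; rewrite ltey_eq fin1//; exact: measurable_cbox.
have : ae_eq L setT (g^\+)%E (g^\-)%E.
  apply: integral_ae_eq => //; first exact: integrable_funepos.
    exact: measurable_funeneg.
  by move=> E _ mE; exact: m12.
apply: filterS => x /(_ I) gE Dx.
move: gE; rewrite funeposE funenegE /g patchE mem_set//= -!EFin_max => -[].
by case: (leP (h x) 0) => h1; case: (leP (- h x) 0) => h2; lra.
Qed.

End Boxes.

(** * Passing to the limit in the cutoffs *)

Section BoxCutoffLimits.
Variables (R : realType) (n : nat).
Local Notation T := 'cV[R]_n.
Local Notation L := (@lebn R n).
Local Notation eps m := (m.+1%:R^-1 : R).

Lemma cvg_inv_succ_right : (fun m => eps m) @ \oo --> (0 : R)^'+.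
Proof.
move=> P [e /= e0 eP].
have /cvgrPdist_lt/(_ e e0) := @cvg_harmonic R.
by apply: filterS => m me; apply: eP; rewrite //= invr_gt0.
Qed.

Lemma box_cutoff_cvg (a b x : T) : (forall i, a i 0 <= b i 0) ->
  (fun m => box_cutoff (eps m) a b x) @ \oo --> (\1_(cbox a b) x : R).
Proof.
move=> ab; apply: (@cvg_near_cst _ _ _ _ _ _).
exact: (cvg_inv_succ_right (box_cutoff_indic x ab)).
Qed.

Lemma measurable_box_cutoff e (a b : T) D : measurable_fun D (box_cutoff e a b).
Proof.
apply: measurable_funTS; apply: continuous_measurable_mx.
exact/smooth_expr_continuous/smooth_expr_box_cutoff.
Qed.

Lemma charge_integral_box_cutoff_cvg (nu : {charge set T -> \bar R}) (Omega : set T)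
    (a b : T) : measurable Omega -> (forall i, a i 0 <= b i 0) ->
  cbox a b `<=` Omega ->
  (fun m => charge_integral nu Omega (box_cutoff (eps m) a b)) @ \oo -->
    fine (nu (cbox a b)).
Proof.
move=> mO ab abO; apply: charge_integral_cvg => //.
- exact: measurable_cbox.
- by move=> m; exact: measurable_box_cutoff.
- by move=> m x; exact: box_cutoff_norm_le1.
- by move=> x _; exact: box_cutoff_cvg.
Qed.

(** Since [eps m <= 1], a margin of 1 below the box accommodates the supports for all [m]. *)
Lemma test_function_box_cutoff_eps (a b : T) (Omega : set T) m :
  (forall i, a i 0 <= b i 0) -> kbox (a - const_mx 1) b `<=` Omega ->
  test_function Omega (box_cutoff (eps m) a b).
Proof.
move=> ab abO; apply: test_function_box_cutoff => // x abx; apply: abO => i.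
have := abx i; rewrite !mxE => /andP[h ->]; rewrite andbT.
by apply: le_trans h; rewrite lerD2l lerN2 invf_le1// ler1n.
Qed.

(** The left side of [is_symgrad] is symmetric in [i] and [j], so the two charges have equal
    integrals on cutoffs, hence equal values on the box in the limit. *)
Lemma symgrad_box_sym (Omega : set T) u Eu (a b : T) i j : measurable Omega ->
  is_symgrad Omega u Eu -> (forall i, a i 0 <= b i 0) ->
  kbox (a - const_mx 1) b `<=` Omega -> Eu i j (cbox a b) = Eu j i (cbox a b).
Proof.
move=> mO Eu_u ab abO.
have abO' : cbox a b `<=` Omega.
  move=> x abx; apply: abO => k; have := abx k; rewrite !mxE => /andP[h1 /ltW->].
  by rewrite andbT; apply: le_trans h1; rewrite gerBl.
have lij := charge_integral_box_cutoff_cvg (nu := Eu i j) mO ab abO'.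
have lji := charge_integral_box_cutoff_cvg (nu := Eu j i) mO ab abO'.
have E : (fun m => charge_integral (Eu i j) Omega (box_cutoff (eps m) a b)) =
         (fun m => charge_integral (Eu j i) Omega (box_cutoff (eps m) a b)).
  apply/funext => m; have tphi := test_function_box_cutoff_eps m ab abO.
  move: (box_cutoff _ _ _) tphi => phi tphi.
  apply: oppr_inj; rewrite -(Eu_u _ tphi i j) -(Eu_u _ tphi j i).
  apply: (congr1 fine); apply: eq_integral => x _.
  exact: (congr1 (fun t : R => (2^-1 * t)%:E) (addrC _ _)).
have mab := measurable_cbox a b.
rewrite -[LHS]fineK ?fin_num_measure// -[RHS]fineK ?fin_num_measure//; congr EFin.
by rewrite E in lij; exact: cvg_unique lij lji.
Qed.

End BoxCutoffLimits.

(** * The total strain of a period cell *)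

Section UnitCellStrain.
Variables (R : realType) (n : nat).
Local Notation T := 'cV[R]_n.
Local Notation L := (@lebn R n).
Local Notation unitv j := (delta_mx j 0 : T).
Local Notation eps m := (m.+1%:R^-1 : R).

Lemma eps_le1 m : eps m <= 1. Proof. by rewrite invf_le1// ler1n. Qed.

Lemma Zn_periodic_field_unitv (xi : 'M[R]_n) (u : T -> T) i j :
  Zn_periodic_field (fun x => u x - xi *m x) ->
  {ae L, forall x, u (x + unitv j) i 0 = u x i 0 + xi i j}.
Proof.
move=> /(_ (delta_mx j 0)); apply: filterS => x; rewrite map_delta_mx => ux.
rewrite -[u (x + unitv j)](subrK (xi *m (x + unitv j))) ux.
by rewrite mulmxDr addrA subrK -colE !mxE.
Qed.

Lemma symgrad_unit_cell (Omega : set T) (u : T -> T) Eu (xi : 'M[R]_n) i j :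
  measurable Omega -> (L Omega < +oo)%E -> nball 2 `<=` Omega ->
  sym_mx xi -> L1_field Omega u -> is_symgrad Omega u Eu ->
  Zn_periodic_field (fun x => u x - xi *m x) ->
  Eu i j (@half_open_cell R n) = (xi i j)%:E.
Proof.
move=> mO LO BO sxi L1u Eu_u per.
have ab k : (0 : T) k 0 <= (const_mx 1 : T) k 0 by rewrite !mxE.
have kO : kbox ((0 : T) - const_mx 1) (const_mx 1) `<=` Omega.
  move=> x xk; apply: BO; apply: mx_norm_le => // k l; rewrite ord1.
  have := xk k; rewrite !mxE => /andP[h1 h2].
  by rewrite ler_norml; apply/andP; split; lra.
have cO : cbox (0 : T) (const_mx 1) `<=` Omega.
  move=> x xc; apply: kO => k; have := xc k; rewrite !mxE => /andP[h1 /ltW->].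
  by rewrite andbT; apply: le_trans h1; rewrite sub0r oppr_le0.
pose phi m := box_cutoff (eps m) (0 : T) (const_mx 1).
have tphi m : test_function Omega (phi m) by exact: test_function_box_cutoff_eps.
have phi0 m x : ~ Omega x -> phi m x = 0.
  by move=> /(test_function_out (tphi m)); exact: nbhs_singleton.
have lim := charge_integral_box_cutoff_cvg (nu := Eu i j) mO ab cO.
pose mu : {finite_measure set T -> \bar R} := mfrestr mO LO.
have mC := measurable_cbox (0 : T) (const_mx 1).
(* On these cutoffs the charge acts as [xi i j] times Lebesgue measure, although the two need not
   agree as measures. *)
have intE m : charge_integral (Eu i j) Omega (phi m) =
    xi i j * \int[mu]_(x in Omega) phi m x.
  have e0 : 0 < eps m by rewrite invr_gt0.
  have I1 := Rintegral_partial_box_cutoff e0 (eps_le1 m) mO BO (L1u i)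
    (Zn_periodic_field_unitv i j per).
  have I2 := Rintegral_partial_box_cutoff e0 (eps_le1 m) mO BO (L1u j)
    (Zn_periodic_field_unitv j i per).
  apply: oppr_inj; rewrite -(Eu_u _ (tphi m) i j) (Rintegral_half_sum mO I1 I2).
  rewrite !Rintegral_psi ?eps_le1//.
  have -> : \int[mu]_(x in Omega) phi m x = \int[L]_x phi m x.
    rewrite -(Rintegral_eq0_out (phi0 m)); congr fine.
    by apply: eq_measure_integral => A mA AO; rewrite /mu/=/mfrestr/mrestr setIidl.
  have -> : xi j i = xi i j by rewrite -[in LHS]sxi mxE.
  by rewrite -/(phi m); field.
have lim' : (fun m => charge_integral (Eu i j) Omega (phi m)) @ \oo --> xi i j * 1.
  under eq_fun do rewrite intE.
  apply: cvgM; first exact: cvg_cst.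
  have -> : (1 : R) = fine (mu (cbox (0 : T) (const_mx 1))).
    rewrite /mu/=/mfrestr/mrestr setIidl// -half_open_cellE.
    by rewrite [X in fine X]lebn_half_open_cell.
  apply: Rintegral_indic_cvg => //.
  - by move=> m; exact: measurable_box_cutoff.
  - by move=> m x; exact: box_cutoff_norm_le1.
  - by move=> x _; exact: box_cutoff_cvg.
rewrite half_open_cellE -[LHS]fineK ?fin_num_measure//; congr EFin.
by rewrite -[RHS]mulr1; exact: cvg_unique lim lim'.
Qed.

End UnitCellStrain.

(** * Coercivity of the quadratic form on symmetric matrices *)

Section Coercivity.
Variables (R : realType) (n : nat) (A : {linear 'M[R]_n -> 'M[R]_n}).
Hypothesis HA : posdef_sym_operator A.

Lemma continuous_linear_entry i j : continuous (fun M : 'M[R]_n => A M i j).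
Proof.
rewrite (_ : (fun M => _) = \sum_k \sum_l
    (fun M : 'M[R]_n => M k l * A (delta_mx k l) i j)).
  elim/big_ind: _ => [|g h cg ch|k _] M; first exact: cst_continuous.
    by apply: (@continuousD _ _ _ g h M (cg M) (ch M)).
  move: M; elim/big_ind: _ => [|g h cg ch|l _] M; first exact: cst_continuous.
    by apply: (@continuousD _ _ _ g h M (cg M) (ch M)).
  apply: (@continuousM _ _ (fun M : 'M[R]_n => M k l) (cst (A (delta_mx k l) i j))).
    exact: coord_continuous.
  exact: cst_continuous.
apply/funext => M; rewrite [in LHS](matrix_sum_delta M) linear_sum summxE fct_sumE.
apply: eq_bigr => k _; rewrite linear_sum summxE fct_sumE.
by apply: eq_bigr => l _; rewrite linearZ mxE.
Qed.

Lemma continuous_mdot (f g : 'M[R]_n -> 'M[R]_n) :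
  (forall i j, continuous (fun M => f M i j)) ->
  (forall i j, continuous (fun M => g M i j)) ->
  continuous (fun M => mdot (f M) (g M)).
Proof.
move=> cf cg.
rewrite (_ : (fun M => _) = \sum_i \sum_j (fun M => f M i j * g M i j)).
  elim/big_ind: _ => [|p q cp cq|i _] M; first exact: cst_continuous.
    by apply: (@continuousD _ _ _ p q M (cp M) (cq M)).
  move: M; elim/big_ind: _ => [|p q cp cq|j _] M; first exact: cst_continuous.
    by apply: (@continuousD _ _ _ p q M (cp M) (cq M)).
  exact: (@continuousM _ _ _ _ M (cf i j M) (cg i j M)).
apply/funext => M; rewrite /mdot fct_sumE; apply: eq_bigr => i _.
by rewrite fct_sumE.
Qed.

Lemma continuous_mdot_linear : continuous (fun M => mdot (A M) M).
Proof.
apply: continuous_mdot => i j; first exact: continuous_linear_entry.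
exact: coord_continuous.
Qed.

Lemma mdotZ (t : R) (M : 'M[R]_n) : mdot (A (t *: M)) (t *: M) = t ^+ 2 * mdot (A M) M.
Proof.
rewrite /mdot mulr_sumr; apply: eq_bigr => i _; rewrite mulr_sumr.
by apply: eq_bigr => j _; rewrite linearZ !mxE; ring.
Qed.

(** The form attains a positive minimum on the compact unit sphere of symmetric matrices;
    homogeneity extends the bound. *)
Lemma mdot_coercive : exists2 al, 0 < al &
  forall M, sym_mx M -> al * mdot M M <= mdot (A M) M.
Proof.
have [_ _ Apos] := HA.
pose K : set 'M[R]_n := [set M | sym_mx M /\ mdot M M = 1].
have cmdot : continuous (fun M : 'M[R]_n => mdot M M).
  by apply: (@continuous_mdot id id) => i j; exact: coord_continuous.
have cK : compact K.
  apply: bounded_closed_compact_mx.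
    exists 1; split; rewrite ?num_real// => r r1 M [_ M1] /=.
    apply: mx_norm_le => [|i j]; first by rewrite ltW// (lt_trans ltr01).
    apply: le_trans (entry_le_enorm _ _ _) _.
    by rewrite /enorm M1 sqrtr1 ltW.
  rewrite (_ : K = (\bigcap_(ij in [set: 'I_n * 'I_n])
      (fun M : 'M[R]_n => M ij.2 ij.1 - M ij.1 ij.2) @^-1` [set 0]) `&`
      (fun M : 'M[R]_n => mdot M M) @^-1` [set 1]).
    apply: closedI; last first.
      by apply: closed_comp; [move=> M _; exact: cmdot|exact: closed_eq].
    apply: closed_bigI => -[i j] _; apply: closed_comp; last exact: closed_eq.
    move=> M _; apply: (@continuousB _ _ _ (fun M : 'M[R]_n => M j i)
      (fun M : 'M[R]_n => M i j)); exact: coord_continuous.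
  apply/seteqP; split => M [sM M1]; split => //.
    by move=> [i j] _ /=; have /matrixP/(_ i j) := sM; rewrite mxE => ->; rewrite subrr.
  by apply/matrixP => i j; rewrite mxE; apply/eqP; rewrite -subr_eq0; apply/eqP/(sM (i, j)).
have normalize M : sym_mx M -> M != 0 -> exists t, [/\ t != 0, K (t *: M) & t ^+ 2 * mdot M M = 1].
  move=> sM M0; have e0 : enorm M != 0 by apply: contra_neq M0; exact: enorm_eq0.
  have h : (enorm M)^-1 ^+ 2 * mdot M M = 1.
    by rewrite -enorm_sqr -exprMn mulVf// expr1n.
  exists (enorm M)^-1; split; rewrite ?invr_neq0//; split.
    by rewrite /sym_mx linearZ/= sM.
  rewrite -h /mdot mulr_sumr; apply: eq_bigr => i _; rewrite mulr_sumr.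
  by apply: eq_bigr => j _; rewrite !mxE; ring.
(* The sphere is empty for [n = 0], where every matrix is zero. *)
have [[M0 KM0]|nK] := pselect (K !=set0); last first.
  exists 1 => // M sM; have [->|M0] := eqVneq M 0.
    by rewrite !mdotr0 mulr0.
  by have [t [_ Kt _]] := normalize M sM M0; exfalso; apply: nK; exists (t *: M).
have [c /set_mem[sc c1] cmin] : exists2 c, c \in K & forall M, M \in K ->
    mdot (A c) c <= mdot (A M) M.
  apply: compact_EVT_min => //; first by exists M0.
  by apply: continuous_subspaceT; exact: continuous_mdot_linear.
have c0 : c != 0.
  by apply/eqP => c0; move: c1; rewrite c0 mdotr0 => /esym/eqP; rewrite oner_eq0.
exists (mdot (A c) c) => [|M sM]; first exact: Apos.
have [->|M1] := eqVneq M 0; first by rewrite !mdotr0 mulr0.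
have [t [t0 Kt tM]] := normalize M sM M1.
have := cmin _ (mem_set Kt); rewrite mdotZ => h.
have t2 : 0 < t ^+ 2 by rewrite exprn_even_gt0.
by rewrite -(ler_pM2l t2) mulrCA tM mulr1.
Qed.

End Coercivity.

(** * Almost everywhere symmetry of the absolutely continuous strain *)

Section SymmetricDensity.
Variables (R : realType) (n : nat).
Local Notation T := 'cV[R]_n.
Local Notation L := (@lebn R n).

Lemma symtensor_entryE (a b : T) i j :
  symtensor a b i j = 2^-1 * (a i 0 * b j 0 + b i 0 * a j 0).
Proof. by rewrite /symtensor !mxE !big_ord1 !mxE. Qed.

Lemma symtensor_entryC (a b : T) i j : symtensor a b i j = symtensor a b j i.
Proof. by rewrite !symtensor_entryE; ring. Qed.

Lemma symtensor_entry_le (a b : T) i j : enorm b = 1 -> `|symtensor a b i j| <= enorm a.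
Proof.
move=> b1; have h k l : `|a k 0 * b l 0| <= enorm a.
  by rewrite normrM -[leRHS]mulr1 ler_pM//; [|rewrite -b1]; exact: entry_le_enorm.
rewrite symtensor_entryE normrM gtr0_norm ?invr_gt0//.
rewrite mulrC ler_pdivrMr// mulr_natr mulr2n.
apply: le_trans (ler_normD _ _) _; apply: lerD; first exact: h.
by rewrite mulrC; exact: h.
Qed.

Lemma jump_strain_le (u : T -> T) x i j : jump_set u x ->
  `|jump_strain u x i j| <= enorm (jump u x).
Proof.
move=> Jx; apply: symtensor_entry_le.
(* On the jump set [xget] returns a genuine triple and not its default, so the normal is a unit
   vector. *)
have : jump_triple u x (jump_data u x) by exact: xgetPex.
by rewrite /jump_normal; case: (jump_data u x) => -[a b] nu [].
Qed.

(** On boxes [Eu] is symmetric, and so is [Es] by assumption; by subtraction the integrals of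
    [e x i j] and [e x j i] agree on every box in the cell. *)
Lemma lebesgue_decomposition_sym_ae (Omega : set T) (u : T -> T) Eu e Es i j :
  measurable Omega -> kbox (const_mx (-1)) (const_mx 1) `<=` Omega ->
  is_symgrad Omega u Eu -> lebesgue_decomposition Omega Eu e Es ->
  (forall B, measurable B -> B `<=` Omega -> Es i j B = Es j i B) ->
  {ae L, forall x, @half_open_cell R n x -> e x i j = e x j i}.
Proof.
move=> mO KO Eu_u [inte decE _] EsC.
have mC := @measurable_half_open_cell R n.
have CO : @half_open_cell R n `<=` Omega.
  move=> x xC; apply: KO => k; have /andP[h1 /ltW h2] := xC k.
  by rewrite !mxE h2 andbT; apply: le_trans h1; rewrite oppr_le0.
have intC k l : L.-integrable (@half_open_cell R n) (EFin \o (fun x => e x k l)).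
  exact: (integrableS mO mC CO (inte k l)).
have intd : L.-integrable (@half_open_cell R n) (EFin \o (fun x => e x i j - e x j i)).
  exact: (integrableB mC (intC i j) (intC j i)).
suff : {ae L, forall x, @half_open_cell R n x -> e x i j - e x j i = 0}.
  by apply: filterS => x h /h/eqP; rewrite subr_eq0 => /eqP.
rewrite half_open_cellE in intd mC CO intC *.
apply: box_integral_eq0_ae => // a b; rewrite cboxI.
set c := \col_i Num.max _ _; set d := \col_i Num.min _ _.
have cdC : cbox c d `<=` cbox (0 : T) (const_mx 1).
  by rewrite /c /d -cboxI; exact: subIsetr.
(* These bounds keep the box enlarged by the margin 1 inside the cube from -1 to 1, hence inside
   [Omega]. *)
have c0 k : 0 <= c k 0 by rewrite mxE [(0 : T) k 0]mxE le_max lexx orbT.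
have d1 k : d k 0 <= 1 by rewrite mxE [const_mx _ k 0]mxE ge_min lexx orbT.
clearbody c d; have mcd := measurable_cbox c d.
have icd k l : L.-integrable (cbox c d) (EFin \o (fun x => e x k l)).
  exact: (integrableS mC mcd cdC (intC k l)).
(* The cutoffs require ordered endpoints, which a nonempty intersection guarantees. *)
have [[x0 x0cd]|ncd] := pselect (cbox c d !=set0); last first.
  rewrite (_ : cbox c d = set0) ?integral_set0//.
  by apply/seteqP; split => // x xcd; apply: ncd; exists x.
have cd k : c k 0 <= d k 0.
  by have /andP[h1 /ltW h2] := x0cd k; exact: le_trans h1 h2.
have cdO : cbox c d `<=` Omega by exact: subset_trans cdC CO.
have kO : kbox (c - const_mx 1) d `<=` Omega.
  move=> x xk; apply: KO => k; have := xk k; rewrite !mxE => /andP[h1 h2].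
  apply/andP; split; last exact: le_trans h2 (d1 k).
  by apply: le_trans h1; have := c0 k; lra.
have E := symgrad_box_sym i j mO Eu_u cd kO.
have fEs : Es j i (cbox c d) \is a fin_num by exact: fin_num_measure.
have : (\int[L]_(x in cbox c d) (e x i j)%:E = \int[L]_(x in cbox c d) (e x j i)%:E)%E.
  move: E; rewrite !decE// (EsC _ mcd cdO) => /(congr1 (fun z => z - Es j i (cbox c d)))%E.
  by rewrite !addeK.
move=> Eij; have := integralB mcd (icd i j) (icd j i).
by rewrite /= Eij subee//; exact: (integrable_fin_num mcd (icd j i)).
Qed.

End SymmetricDensity.

(** * The lower bound *)

Section CellEnergyBound.
Variables (R : realType) (n : nat) (n_gt0 : (0 < n)%N).
Local Notation T := 'cV[R]_n.
Local Notation L := (@lebn R n).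
Local Notation H := (@hausdorff R n.-1 n).
Variables (A : {linear 'M[R]_n -> 'M[R]_n}) (HA : posdef_sym_operator A).

(** The cells are nested and both have volume 1, so their difference is negligible. *)
Lemma integral_half_open_cell (f : T -> \bar R) :
  measurable_fun (@half_open_cell R n) f -> (forall x, 0 <= f x)%E ->
  (\int[L]_(x in @half_open_cell R n) f x = \int[L]_(x in @unit_cell R n) f x)%E.
Proof.
move=> mf f0.
have mC := @measurable_half_open_cell R n; have mU := @measurable_unit_cell R n.
have UC : @unit_cell R n `<=` @half_open_cell R n.
  by move=> x xU i; have /andP[/ltW-> ->] := xU i.
rewrite (@ge0_negligible_integral _ _ _ L _
  (@half_open_cell R n `\` @unit_cell R n))//.
- by rewrite setDD setIidr.
- exact: measurableD.
- have h : L (@half_open_cell R n) = 1%E := lebn_half_open_cell R n.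
  have hfin : (L (@half_open_cell R n) < +oo)%E by rewrite h ltry.
  have hI : L (@half_open_cell R n `&` @unit_cell R n) = 1%E.
    by rewrite setIidr//; exact: lebn_unit_cell.
  apply: etrans (measureD mC mU hfin) _.
  by apply: etrans (congr2 (fun a b => a - b)%E h hI) _; rewrite subee.
Qed.

(** Young's inequality [m <= eps + m^2 / (4 eps)] for an entry, whose square is controlled by
    coercivity. *)
Lemma entry_le_Anorm (al eps : R) (M : 'M[R]_n) i j : 0 < al -> 0 < eps ->
  al * mdot M M <= mdot (A M) M ->
  `|M i j| <= eps + (4 * eps * al)^-1 * Anorm A M ^+ 2.
Proof.
move=> al0 eps0 coer.
have AM : 0 <= mdot (A M) M by apply: le_trans coer; rewrite mulr_ge0 ?(ltW al0) ?mdot_ge0.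
rewrite sqr_sqrtr//.
have M2 : `|M i j| ^+ 2 <= al^-1 * mdot (A M) M.
  rewrite real_normK ?num_real//; apply: le_trans (sqr_entry_le_mdot _ _ _) _.
  by rewrite mulrC ler_pdivlMr// mulrC.
have : (4 * eps) * `|M i j| <= (4 * eps) * (eps + (4 * eps * al)^-1 * mdot (A M) M).
  have -> : 4 * eps * (eps + (4 * eps * al)^-1 * mdot (A M) M) =
      4 * eps ^+ 2 + al^-1 * mdot (A M) M by field; rewrite !gt_eqF.
  have := sqr_ge0 (`|M i j| - 2 * eps); nra.
by rewrite ler_pM2l// mulr_gt0.
Qed.

(** The entry of [xi] is the total strain of the cell, that is the integral of [e] plus the singular
    part; the first is bounded by the quadratic energy, the second by the jump energy. *)
Lemma entry_le_cell_integrals (al eps : R) (B : set T) (K0 : set 'M[R]_n)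
    (xi : 'M[R]_n) (u : T -> T) (e : T -> 'M[R]_n) i j : 0 < al -> 0 < eps ->
  (forall M, sym_mx M -> al * mdot M M <= mdot (A M) M) ->
  sym_mx xi -> admissible B K0 xi u e ->
  (`|xi i j|%:E <= eps%:E +
    (4 * eps * al)^-1%:E * \int[L]_(x in @unit_cell R n) (Anorm A (e x) ^+ 2)%:E +
    \int[H]_(x in jump_set u `&` @half_open_cell R n) (enorm (jump u x))%:E)%E.
Proof.
move=> al0 eps0 coer sxi [Su _ _ per].
pose Omega : set T := obox (const_mx (-4)) (const_mx 4).
have oO : open Omega by exact: open_obox.
have mO := open_measurable_mx oO.
have bO : bounded_set Omega.
  exists 4; split; rewrite ?num_real// => r r4 x Ox /=.
  apply: mx_norm_le => [|k l]; first by rewrite ltW// (lt_trans _ r4).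
  rewrite ord1 ler_norml; have := Ox k; rewrite !mxE => /andP[h1 h2].
  by apply/andP; split; lra.
have BO : nball 2 `<=` Omega.
  move=> x x2 k; rewrite !mxE.
  have := le_trans (mx_norm_entry_le x k 0) x2; rewrite ler_norml => /andP[h1 h2].
  by apply/andP; split; lra.
have KO : kbox (const_mx (-1)) (const_mx 1) `<=` Omega.
  move=> x xk k; have := xk k; rewrite !mxE => /andP[h1 h2].
  by apply/andP; split; lra.
have [Eu [Es [[L1u Eu_u] dec _ EsE]]] := Su Omega oO bO.
have [inte decE _] := dec.
have mC := @measurable_half_open_cell R n; have mU := @measurable_unit_cell R n.
have UC : @unit_cell R n `<=` @half_open_cell R n.
  by move=> x xU k; have /andP[/ltW-> ->] := xU k.
have CO : @half_open_cell R n `<=` Omega.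
  move=> x xC; apply: KO => k; have /andP[h1 /ltW h2] := xC k.
  by rewrite !mxE h2 andbT; apply: le_trans h1; rewrite oppr_le0.
have EsC k l D : measurable D -> D `<=` Omega -> Es k l D = Es l k D.
  move=> mD DO; rewrite !EsE//; congr integral; apply/funext => x.
  by rewrite /jump_strain symtensor_entryC.
(* Needed because coercivity is available on symmetric matrices only. *)
have symE : {ae L, forall x, @half_open_cell R n x -> sym_mx (e x)}.
  have h : {ae L, forall x, forall kl : 'I_n * 'I_n,
      @half_open_cell R n x -> e x kl.1 kl.2 = e x kl.2 kl.1}.
    apply: filter_forall => -[k l] /=.
    exact: (lebesgue_decomposition_sym_ae mO KO Eu_u dec (EsC k l)).
  apply: filterS h => x h xC; apply/matrixP => k l; rewrite mxE.
  exact: (h (l, k)).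
have me k l : measurable_fun (@half_open_cell R n) (fun x => e x k l).
  apply/measurable_EFinP; apply: measurable_int.
  exact: (integrableS mO mC CO (inte k l)).
have H0 : H (set0 : set T) = 0%E by exact: hausdorff0.
have EsB : (`|Es i j (@half_open_cell R n)| <=
    \int[H]_(x in jump_set u `&` @half_open_cell R n) (enorm (jump u x))%:E)%E.
  rewrite EsE// setIC; apply: (abse_integral_le_set_function H0) => x [Jx _].
  exact: jump_strain_le.
have eB : (`|\int[L]_(x in @half_open_cell R n) (e x i j)%:E| <= eps%:E +
    (4 * eps * al)^-1%:E * \int[L]_(x in @unit_cell R n) (Anorm A (e x) ^+ 2)%:E)%E.
  have mabs : measurable_fun (@half_open_cell R n) (fun x => `|(e x i j)%:E|%E).
    by apply: measurableT_comp => //; apply/measurable_EFinP.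
  apply: le_trans (le_abse_integral _ mC _) _; first by apply/measurable_EFinP.
  rewrite integral_half_open_cell//.
  have mW : measurable_fun (@unit_cell R n) (fun x => (Anorm A (e x) ^+ 2)%:E).
    have cA : continuous (fun M : 'M[R]_n => Anorm A M ^+ 2).
      move=> M; apply: (@continuous_comp _ _ _ (Anorm A) (fun t => t ^+ 2)).
        apply: (@continuous_comp _ _ _ (fun M : 'M[R]_n => mdot (A M) M) Num.sqrt).
          exact: continuous_mdot_linear.
        exact: sqrt_continuous.
      exact: exprn_continuous.
    apply/measurable_EFinP; apply: (measurableT_comp (continuous_measurable_mx cA)).
    apply: measurable_fun_mx => k l; exact: measurable_funS (me k l).
  have K0' : 0 <= (4 * eps * al)^-1 by rewrite invr_ge0 !mulr_ge0// ltW.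
  have W0 x : (0 <= (Anorm A (e x) ^+ 2)%:E)%E by rewrite lee_fin sqr_ge0.
  have KW0 x : (0 <= (4 * eps * al)^-1%:E * (Anorm A (e x) ^+ 2)%:E)%E.
    by rewrite mule_ge0// lee_fin.
  have mKW : measurable_fun (@unit_cell R n)
      (fun x => (4 * eps * al)^-1%:E * (Anorm A (e x) ^+ 2)%:E)%E.
    exact: measurable_funeM.
  (* The unit cell has volume 1, so [eps] is the integral of a constant and it suffices to compare
     integrands. *)
  rewrite -ge0_integralZl// -[X in (X + _)%E]mule1 -(lebn_unit_cell R n) -integral_cst//.
  rewrite -ge0_integralD//; last by move=> x _; rewrite lee_fin ltW.
  apply: ae_ge0_le_integral => //.
  - exact: measurable_funS mabs.
  - by move=> x _; rewrite adde_ge0// lee_fin ltW.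
  - exact: emeasurable_funD.
  apply: filterS symE => x sx xU; rewrite -EFinM -EFinD lee_fin.
  by apply: entry_le_Anorm => //; apply: coer; apply: sx; exact: UC.
have Euxi := symgrad_unit_cell i j mO (bounded_lebn_lty mO bO) BO sxi L1u Eu_u per.
apply: le_trans (_ : `|Eu i j (@half_open_cell R n)| <= _)%E; first by rewrite Euxi.
rewrite decE//; apply: le_trans (lee_abs_add _ _) _.
exact: leeD.
Qed.

Lemma f_hom_ge_linear : exists2 c1, 0 < c1 &
  forall (B : set T) (K0 : set 'M[R]_n) (xi : 'M[R]_n), sym_mx xi ->
    ((c1 * (enorm xi - 1))%:E <= f_hom A B K0 xi)%E.
Proof.
have [al al0 coer] := mdot_coercive HA.
(* The number of entries: with [eps = N^-1] the constants in the entrywise bounds add up to the 1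
   subtracted from [enorm xi]. *)
pose N : R := n%:R * n%:R.
have N0 : 0 < N by rewrite mulr_gt0// ltr0n.
pose K : R := (4 * N^-1 * al)^-1.
have K0 : 0 < K by rewrite invr_gt0 !mulr_gt0// invr_gt0.
(* Chosen so that [K * W + S <= C * (2^-1 * W + S)], the energy on the right. *)
pose C : R := 2 * K + 1.
have C0 : 0 < C by rewrite /C; lra.
exists (N * C)^-1 => [|B K0' xi sxi]; first by rewrite invr_gt0 mulr_gt0.
apply/ereal_infP => _ [u [e [adm ->]]]; rewrite /cell_energy.
have NV0 : 0 < N^-1 by rewrite invr_gt0.
have bound i j := entry_le_cell_integrals i j al0 NV0 coer sxi adm.
rewrite -/K in bound.
set W := (\int[L]_(x in _) _)%E in bound *.
set S := (\int[H]_(x in _) _)%E in bound *.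
have W0 : (0 <= W)%E by apply: integral_ge0 => x _; rewrite lee_fin sqr_ge0.
have S0 : (0 <= S)%E.
  rewrite /S ge0_integral_simple_sup ?hausdorff0//; last first.
    by move=> x _; rewrite lee_fin sqrtr_ge0.
  apply: simple_sup_ge0; first exact: hausdorff0.
  by move=> x; rewrite patchE; case: ifP => // _; rewrite lee_fin sqrtr_ge0.
(* If one of the two integrals is infinite, so is the energy and the bound is trivial. *)
clearbody W S; move: W S W0 S0 bound => [W| |] [S| |] //; last 3 first.
- by move=> _ _ _; rewrite leey.
- by move=> _ _ _; rewrite gt0_muley ?lte_fin ?invr_gt0// leey.
- by move=> _ _ _; rewrite gt0_muley ?lte_fin ?invr_gt0// leey.
rewrite -EFinM -EFinD !lee_fin => W0 S0 bound.
have NC0 : 0 < N * C by exact: mulr_gt0.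
rewrite (ler_pdivrMl _ _ NC0) lerBlDr.
apply: le_trans (enorm_le_sum xi) _.
have le1 i j : `|xi i j| <= N^-1 + C * (2^-1 * W + S).
  have := bound i j; rewrite lee_fin /C; nra.
apply: (@le_trans _ _ (\sum_(i < n) \sum_(j < n) (N^-1 + C * (2^-1 * W + S)))).
  by apply: ler_sum => i _; apply: ler_sum => j _; exact: le1.
rewrite !sumr_const !card_ord; set t := (_ + C * _).
rewrite -[t *+ n]mulr_natl -[_ *+ n]mulr_natl mulrA -/N /t mulrDr mulfV ?gt_eqF//.
by rewrite [leLHS]addrC mulrA.
Qed.

End CellEnergyBound.

Theorem proposition5p1 (R : realType) (n : nat) (n_gt0 : (0 < n)%N)
  (A : {linear 'M[R]_n -> 'M[R]_n}) (HA : posdef_sym_operator A)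
  (B : set 'cV[R]_n) (B_closed : closed B) (B_rect : rectifiable n.-1 B)
  (B_per : Zn_periodic_set B)
  (K0 : set 'M[R]_n) (HK0 : slip_cone K0) :
  exists c1 c2 : R, [/\ 0 < c1, 0 < c2 &
    forall xi : 'M[R]_n, sym_mx xi ->
      ((c1 * (enorm xi - 1))%:E <= f_hom A B K0 xi)%E /\
      (f_hom A B K0 xi <= (c2 * enorm xi ^+ 2)%:E)%E].
Proof.
have [c1 c1_gt0 lower] := f_hom_ge_linear n_gt0 HA.
have [C C_gt0 upper] := mdot_linear_le A.
(* The factor [2^-1] is that of the elastic energy of the linear field. *)
exists c1, (2^-1 * C); split=> [//||xi sxi]; first by rewrite mulr_gt0 ?invr_gt0.
split; first exact: lower.
apply: le_trans (f_hom_le_quadratic n_gt0 HA B K0 sxi) _.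
by rewrite lee_fin -mulrA ler_pM2l ?invr_gt0.
Qed.
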